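(* For all $3\le k<\ell$ with $\ell$ not divisible by $k$: (i) $\delta_{C_\ell^{(k)}}\ge \frac12+\frac{1}{4(\ell-1)}$; (ii) if $k/\gcd(\ell,k)$ is even, then $\delta_{C_\ell^{(k)}}\ge\frac12+\frac{1}{2(\ell-1)}$; and (iii) if $\gcd(\ell,k)=1$ and $k$ is odd, then $\delta_{C_\ell^{(k)}}\ge\frac12+\frac{1-2^{-k}}{2(\ell-1)}$.
   Context: A $k$-graph is a $k$-uniform hypergraph. For $\ell>k\ge 2$, the tight cycle $C_\ell^{(k)}$ is the $k$-graph with vertices $v_1,\dots,v_\ell$ and edges $\{v_i,v_{i+1},\dots,v_{i+k-1}\}$, $i\in\{1,\dots,\ell\}$, indices modulo $\ell$. The degree of a vertex of $H$ is the number of edges of $H$ containing it. $\delta_{k-1}(H)$ is the minimum, over all $(k-1)$-sets $S\subseteq V(H)$, of the number of edges of $H$ containing $S$. A $C_\ell^{(k)}$-decomposition of $H$ is a collection of subgraphs of $H$, each isomorphic to $C_\ell^{(k)}$, such that every edge of $H$ is covered exactly once. $H$ is $C_\ell^{(k)}$-divisible if $|E(H)|$ is divisible by $\ell$ and the degree of every vertex is divisible by $k$. $\delta_{C_\ell^{(k)}}$ is the least $d>0$ such that for every $\varepsilon>0$ there exists $n_0$ such that any $C_\ell^{(k)}$-divisible $k$-graph $H$ on $n\ge n_0$ vertices with $\delta_{k-1}(H)\ge(d+\varepsilon)n$ admits a $C_\ell^{(k)}$-decomposition. *)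

(* Defs.v *)
From HB Require Import structures.
From mathcomp Require Import all_boot all_order all_algebra.
From mathcomp Require Import all_classical all_reals.

Set Implicit Arguments.
Unset Strict Implicit.
Unset Printing Implicit Defensive.

Import Order.TTheory GRing.Theory Num.Theory.

Local Open Scope ring_scope.

(* A hypergraph on the vertex set T is given by its set of edges
   H : {set {set T}}; it is a k-graph when all its edges have size k. *)
Definition kgraph (k : nat) (T : finType) (H : {set {set T}}) : Prop :=
  forall e : {set T}, e \in H -> #|e| = k.

Definition set_degree (T : finType) (H : {set {set T}}) (S : {set T}) : nat :=
  #|[set e in H | S \subset e]|.

Definition vertex_degree (T : finType) (H : {set {set T}}) (v : T) : nat :=
  #|[set e in H | v \in e]|.

(* delta_j(H).  The default value #|H| bounds every set_degree from above, so
   it only matters when T has no j-subset. *)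
Definition min_degree (j : nat) (T : finType) (H : {set {set T}}) : nat :=
  \big[minn/#|H|]_(S : {set T} | #|S| == j) set_degree H S.

(* The tight cycle C_l^(k), with vertices 0, ..., l - 1. *)
Definition tight_edge (k l : nat) (i : 'I_l) : {set 'I_l} :=
  [set j : 'I_l | [exists t : 'I_k, val j == ((i + t) %% l)%N]].

Definition tight_cycle (k l : nat) : {set {set 'I_l}} :=
  [set tight_edge k i | i : 'I_l].

(* Tight cycles have no isolated vertices, so a subgraph isomorphic to one is
   determined by its edge set F; its vertex set is the range of f. *)
Definition tight_cycle_copy (k l : nat) (T : finType) (F : {set {set T}}) :
    Prop :=
  exists f : 'I_l -> T,
    injective f /\ F = [set f @: e | e : {set 'I_l} in tight_cycle k l].

Definition cycle_decomposable (k l : nat) (T : finType) (H : {set {set T}}) :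
    Prop :=
  exists D : {set {set {set T}}},
    (forall F, F \in D -> F \subset H /\ tight_cycle_copy k l F) /\
    (forall e, e \in H -> #|[set F in D | e \in F]| = 1%N).

Definition cycle_divisible (k l : nat) (T : finType) (H : {set {set T}}) :
    Prop :=
  (l %| #|H|)%N /\ (forall v : T, (k %| vertex_degree H v)%N).

Definition forces_decomposition (R : realType) (k l : nat) (d : R) : Prop :=
  0 < d /\
  forall eps : R, 0 < eps ->
  exists n0 : nat, forall (T : finType) (H : {set {set T}}),
    (n0 <= #|T|)%N -> kgraph k H -> cycle_divisible k l H ->
    (d + eps) * #|T|%:R <= (min_degree k.-1 H)%:R ->
    cycle_decomposable k l H.

(* The decomposition threshold.  Since inf set0 = 0, it is the least d such
   that forces_decomposition k l d whenever it is positive: see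
   cycle_threshold_least. *)
Definition cycle_threshold (R : realType) (k l : nat) : R :=
  inf [set d : R | forces_decomposition k l d]%classic.

Lemma cycle_threshold_le (R : realType) (k l : nat) (d : R) :
  forces_decomposition k l d -> cycle_threshold R k l <= d.
Proof.
by move=> hd; apply: ge_inf => //; exists 0 => x [/ltW].
Qed.

Lemma cycle_threshold_least (R : realType) (k l : nat) :
  0 < cycle_threshold R k l ->
  forces_decomposition k l (cycle_threshold R k l) /\
  (forall d : R, forces_decomposition k l d -> cycle_threshold R k l <= d).
Proof.
move=> t0; split; last exact: cycle_threshold_le.
split=> // eps eps0.
have hinf : has_inf [set d : R | forces_decomposition k l d]%classic.
  apply: contrapT => /inf_out h; move: t0.
  by rewrite /cycle_threshold h ltxx.
have [d [d0 hd] dlt] := inf_adherent eps0 hinf.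
have e0 : 0 < cycle_threshold R k l + eps - d by rewrite subr_gt0.
have [n0 hn0] := hd _ e0.
by exists n0 => T H; move: (hn0 T H); rewrite addrC subrK.
Qed.

Lemma cycle_threshold_unique (R : realType) (k l : nat) (d : R) :
  forces_decomposition k l d ->
  (forall d' : R, forces_decomposition k l d' -> d <= d') ->
  cycle_threshold R k l = d.
Proof.
move=> hd hmin; apply/eqP; rewrite eq_le cycle_threshold_le //=.
by apply: lb_le_inf; [exists d | move=> d' /hmin].
Qed.

(* Main.v *)
(* A density d that forces decompositions is bounded from below by exhibiting
   divisible k-graphs of large codegree without a decomposition.

   For k >= 4, split the vertices into two equal halves A and B, take all edges
   e for which |e :&: A| has a fixed parity, and a thin equidistributed part of
   the other edges.  In a tight cycle whose edges all have the chosen parity,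
   consecutive edges meet A equally often, say t times, and k divides l t.  If
   this is impossible, every tight cycle uses an edge from the thin part, which
   must therefore contain a fraction 1 / l of all edges.  In general one puts
   weights on the edges, according to |e :&: A|, with negative sum over the
   k-graph and nonnegative sum over every tight cycle.

   For k = 3 there is a better obstruction, giving 2/3 for every l.  Take three
   equal parts A, B, C and all triples that meet exactly two parts.  Modulo 3,
   the sum of |e :&: B| over the edges e contained in A :|: B vanishes for tight
   cycles, but it is not determined by the vertex degrees: two disjoint edges
   can be exchanged for two others so that all degrees are kept and this sum
   changes by 1.

   Divisibility comes from blowing up: in a k-graph invariant under permutations
   of each class of a vertex partition, without edges inside a class, all degrees
   are divisible by a given number M once the class sizes are divisible by M k!. *)
Require Import Defs.
From mathcomp Require Import all_boot all_order all_algebra.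
From mathcomp Require Import all_classical all_reals.
From mathcomp Require Import fintype finset zify ring lra.

Set Implicit Arguments.
Unset Strict Implicit.
Unset Printing Implicit Defensive.

Import Order.TTheory GRing.Theory Num.Theory.

Local Open Scope ring_scope.

(** * Sums over tight cycles *)

Definition cyc (l : nat) (hl : (0 < l)%N) (n : nat) : 'I_l :=
  Ordinal (ltn_pmod n hl).

Lemma tight_edgeE (k l : nat) (hl : (0 < l)%N) (i : 'I_l) :
  tight_edge k i = [set cyc hl (i + t) | t : 'I_k].
Proof.
apply/setP => j; rewrite inE; apply/existsP/imsetP => [[t /eqP jE]|[t _ ->]].
  by exists t => //; apply: val_inj.
by exists t.
Qed.

Lemma cyc_add_inj (l : nat) (hl : (0 < l)%N) (i t u : nat) :
  (t < l)%N -> (u < l)%N -> cyc hl (i + t) = cyc hl (i + u) -> t = u.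
Proof.
move=> tl ul /(congr1 val) /= /eqP.
by rewrite eqn_modDl !modn_small // => /eqP.
Qed.

Lemma sum_tight_edge (V : nmodType) (k l : nat) (hl : (0 < l)%N)
    (phi : 'I_l -> V) (i : 'I_l) : (k <= l)%N ->
  \sum_(j in tight_edge k i) phi j = \sum_(t < k) phi (cyc hl (i + t)).
Proof.
move=> kl; rewrite (tight_edgeE k hl) big_imset //= => t u _ _ /cyc_add_inj h.
by apply: val_inj; apply: h; apply: leq_trans kl.
Qed.

Lemma mem_tight_edge (k l : nat) (hl : (0 < l)%N) (i : 'I_l) (t : nat) :
  (k <= l)%N -> (t < l)%N -> (cyc hl (i + t) \in tight_edge k i) = (t < k)%N.
Proof.
move=> kl tl; rewrite (tight_edgeE k hl); apply/imsetP/idP => [[u _]|tk].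
  by move/cyc_add_inj => -> //; apply: leq_trans kl.
by exists (Ordinal tk).
Qed.

(* An edge determines its first vertex, the only one whose cyclic predecessor
   lies outside the edge. *)
Lemma tight_edge_inj (k l : nat) : (0 < k)%N -> (k < l)%N ->
  injective (@tight_edge k l).
Proof.
move=> k0 kl i j eij.
have hl : (0 < l)%N by apply: leq_ltn_trans kl.
have : cyc hl (j + 0) \in tight_edge k i by rewrite eij mem_tight_edge // ltnW.
rewrite (tight_edgeE k hl) => /imsetP [[[|t] tk] _ /= jE].
  by apply: val_inj; move: jE => /(congr1 val) /=; rewrite !addn0 !modn_small.
have : cyc hl (j + l.-1) \in tight_edge k i.
  suff -> : cyc hl (j + l.-1) = cyc hl (i + t).
    by rewrite mem_tight_edge //; lia.
  apply: val_inj => /=; move: jE => /(congr1 val) /=.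
  rewrite addn0 (modn_small (ltn_ord j)) => ->; rewrite modnDml.
  by rewrite (_ : (i + t.+1 + l.-1 = i + t + l)%N) ?modnDr //; lia.
by rewrite eij mem_tight_edge //; lia.
Qed.

Lemma sum_tight_cycle_copy (V : nmodType) (k l : nat) (T : finType)
    (f : 'I_l -> T) (W : {set T} -> V) :
  (0 < k)%N -> (k < l)%N -> injective f ->
  \sum_(e in [set f @: e | e : {set 'I_l} in tight_cycle k l]) W e =
  \sum_(i < l) W (f @: tight_edge k i).
Proof.
move=> k0 kl finj; rewrite big_imset /=; last first.
  by move=> e e' _ _; apply: imset_inj.
by rewrite big_imset //= => i j _ _; apply: tight_edge_inj.
Qed.

(** Each edge lies in exactly one copy, so the total weight splits into the weights of the copies.
    [P] will be divisibility by 3 and nonnegativity. *)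
Lemma decomposable_sum (V : nmodType) (k l : nat) (T : finType)
    (H : {set {set T}}) (W : {set T} -> V) (P : V -> Prop) :
  (0 < k)%N -> (k < l)%N -> P 0 -> (forall x y, P x -> P y -> P (x + y)) ->
  (forall f : 'I_l -> T, injective f ->
     (forall i, f @: tight_edge k i \in H) ->
     P (\sum_(i < l) W (f @: tight_edge k i))) ->
  cycle_decomposable k l H -> P (\sum_(e in H) W e).
Proof.
move=> k0 kl P0 PD PW [D [DH Dcov]].
have -> : \sum_(e in H) W e = \sum_(F in D) \sum_(e in F) W e.
  transitivity (\sum_(F in D) \sum_(e in H | e \in F) W e).
    rewrite (exchange_big_dep (fun e => e \in H)) /=; last by move=> F e _ /andP[].
    apply: eq_bigr => e eH; rewrite eH sumr_const.
    rewrite (_ : #|_| = 1%N) ?mulr1n // -[RHS](Dcov e eH).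
    by apply: eq_card => F; rewrite !inE.
  apply: eq_bigr => F FD; have [/subsetP FH _] := DH F FD.
  by apply: eq_bigl => e; case: (boolP (e \in F)) => [/FH ->|]; rewrite ?andbF.
apply: big_ind => // F FD; have [FH [f [finj FE]]] := DH F FD.
rewrite FE sum_tight_cycle_copy //; apply: PW => // i.
apply: (subsetP FH); rewrite FE; apply: imset_f; exact: imset_f.
Qed.

Lemma sum_shift (V : nmodType) (l : nat) (F : nat -> V) (n : nat) :
  (forall i, F (i + l)%N = F i) ->
  \sum_(i < l) F (n + i)%N = \sum_(i < l) F i.
Proof.
move=> Fl; elim: n => [//|n <-].
case: l Fl => [|l] Fl; first by rewrite !big_ord0.
rewrite big_ord_recr [RHS]big_ord_recl /= addrC; congr (_ + _).
  by rewrite addn0 -(Fl n); congr F; lia.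
by apply: eq_bigr => i _; congr F; rewrite /bump /=; lia.
Qed.

(** * Weights of cyclic 0/1-sequences *)

Section CyclicWeights.
Variables (k l : nat) (x : nat -> nat).
Hypotheses (l2 : (1 < l)%N) (xl : forall i, x (i + l)%N = x i)
  (x1 : forall i, (x i <= 1)%N).

Let c (n : nat) : nat := (\sum_(t < k) x (n + t))%N.

Let cS n : (c n.+1 + x n = c n + x (n + k))%N.
Proof.
have -> : (c n.+1 + x n = \sum_(t < k.+1) x (n + t))%N.
  rewrite big_ord_recl addn0 addnC; congr addn.
  by apply: eq_bigr => i _; rewrite /= addSnnS.
by rewrite big_ord_recr.
Qed.

Let c_per n : c (n + l) = c n.
Proof. by apply: eq_bigr => t _; rewrite -(xl (n + t)); congr x; lia. Qed.

Let c_near n : (c n.+1 <= (c n).+1)%N /\ (c n <= (c n.+1).+1)%N.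
Proof. by have := cS n; have := x1 n; have := x1 (n + k); lia. Qed.

Let c_parity n : odd (c n.+1) = odd (c n) -> c n.+1 = c n.
Proof. by have := c_near n; lia. Qed.

(** Each entry of [x] lies in [k] windows, so the window sums over one period add up to [k] times
    the sum of [x]. *)
Let sum_c n : (k %| \sum_(i < l) c (n + i))%N.
Proof.
have per i : c (i + l) = c i by exact: c_per.
rewrite (@sum_shift nat l c n per) exchange_big /=.
rewrite (eq_bigr (fun _ : 'I_k => \sum_(i < l) x i)%N) => [|t _].
  by rewrite sum_nat_const card_ord dvdn_mulr.
rewrite -(@sum_shift nat l x t xl).
by apply: eq_bigr => i _; rewrite addnC.
Qed.

(* Consecutive windows of equal parity have equal sums.  So a cyclic sequence
   whose windows all have parity [eps] has constant window sums [t], with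
   k | l t, and if there is a single exception [u], then k | (l - 1) t + u. *)
Lemma cyclic_weight_ge0 (R : realFieldType) (eps : bool) (w : nat -> R) :
  (forall t, -1 <= w t) ->
  (forall t, odd t != eps -> l%:R / 2 - 1 <= w t) ->
  (forall t, odd t = eps -> (t <= k)%N -> (k %| l * t)%N -> 0 <= w t) ->
  (forall t u, odd t = eps -> odd u != eps -> (t <= k)%N ->
     (u = t.+1 \/ t = u.+1) -> (k %| l.-1 * t + u)%N -> l%:R - 1 <= w u) ->
  0 <= \sum_(i < l) w (\sum_(t < k) x (i + t))%N.
Proof.
move=> w1 wbad wconst wsingle; change (0 <= \sum_(i < l) w (c i)).
have ck n : (c n <= k)%N.
  rewrite -[leqRHS]card_ord -sum1_card.
  by apply: leq_sum => t _.
pose bad := [set i : 'I_l | odd (c i) != eps].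
have l0 : (0 < l)%N by apply: ltnW.
have lE : l%:R - 1 = l.-1%:R :> R by rewrite -subn1 natrB.
have [/cards0_eq b0|] := posnP #|bad|.
  have par i : (i < l)%N -> odd (c i) = eps.
    move=> il; have : Ordinal il \notin bad by rewrite b0 in_set0.
    by rewrite inE negbK => /eqP.
  have cc i : (i < l)%N -> c i = c 0.
    elim: i => [//|i IH] il; rewrite -(IH (ltnW il)); apply: c_parity.
    by rewrite !par // ltnW.
  rewrite (eq_bigr (fun _ => w (c 0))); last by move=> i _; rewrite (cc i).
  rewrite sumr_const card_ord mulrn_wge0 // wconst ?par //.
  have := sum_c 0; rewrite (eq_bigr (fun _ => c 0)); last by move=> i _; rewrite (cc i).
  by rewrite sum_nat_const card_ord.
rewrite leq_eqVlt => /orP [/eqP /esym /eqP /cards1P [j bj]|b2].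
  have wper i : w (c (i + l)) = w (c i) by rewrite c_per.
  have jbad : odd (c j) != eps.
    by have : j \in bad; [rewrite bj set11 | rewrite inE].
  have par i : (i < l.-1)%N -> odd (c (j.+1 + i)) = eps.
    move=> il; pose m := ((j.+1 + i) %% l)%N.
    have cm : c (j.+1 + i) = c m.
      rewrite (divn_eq (j.+1 + i) l) -/m; elim: (_ %/ _)%N => [|d IH].
        by rewrite mul0n.
      by rewrite mulSn -addnA addnC c_per.
    have : cyc l0 (j.+1 + i) \notin bad.
      rewrite bj in_set1 -val_eqE /=; apply/eqP => e.
      have : (j + i.+1 = j + 0 %[mod l])%N.
        by rewrite addn0 (modn_small (ltn_ord j)) -[in RHS]e addSnnS.
      by move/eqP; rewrite eqn_modDl mod0n modn_small //; lia.
    by rewrite inE negbK /= cm => /eqP.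
  have cc i : (i < l.-1)%N -> c (j.+1 + i) = c j.+1.
    elim: i => [_|i IH il]; first by rewrite addn0.
    rewrite -(IH (ltnW il)) addnS; apply: c_parity.
    by rewrite -addnS !par // ltnW.
  have last : c (j.+1 + l.-1) = c j by rewrite -(c_per j); congr c; lia.
  rewrite -(@sum_shift R l (fun i => w (c i)) j.+1 wper).
  have recr (V : nmodType) (F : nat -> V) :
      \sum_(i < l) F i = \sum_(i < l.-1) F i + F l.-1.
    by case: (l) l2 => // n _; rewrite big_ord_recr.
  rewrite (recr R (fun i => w (c (j.+1 + i)))) last.
  rewrite (eq_bigr (fun=> w (c j.+1))) => [|i _]; last by rewrite (cc i).
  have tpar : odd (c j.+1) = eps by rewrite -(addn0 j.+1) par; lia.
  rewrite sumr_const card_ord.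
  (* The single exception makes up for the [l.-1] other windows, each of weight at least -1. *)
  have wj : l%:R - 1 <= w (c j).
    apply: (wsingle (c j.+1)) => //.
      have := c_near j; have : c j.+1 <> c j by move=> e; rewrite -e tpar eqxx in jbad.
      by lia.
    have := sum_c j.+1; rewrite (recr nat (fun i => c (j.+1 + i))) last.
    rewrite (eq_bigr (fun=> c j.+1)) => [|i _]; last by rewrite (cc i).
    by rewrite sum_nat_const card_ord.
  have := lerMn2r l.-1 (-1) (w (c j.+1)); rewrite w1 orbT mulNrn => /idP.
  by move: wj; rewrite lE; lra.
(* With b exceptions the sum is at least b l / 2 - l, which is nonnegative for b >= 2. *)
have : \sum_(i < l) (if i \in bad then l%:R / 2 - 1 else -1) <= \sum_(i < l) w (c i).
  by apply: ler_sum => i _; case: ifPn => [|_]; rewrite ?inE ?w1 // => /wbad.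
apply: le_trans.
rewrite (eq_bigr (fun i => -1 + (if i \in bad then l%:R / 2 else 0))); last first.
  by move=> i _; case: ifP => _; lra.
rewrite big_split /= sumr_const card_ord -big_mkcond /= sumr_const.
have : l%:R / 2 * 2 <= l%:R / 2 * #|bad|%:R :> R.
  by rewrite ler_wpM2l ?divr_ge0 // ler_nat.
by rewrite mulNrn -mulr_natr; lra.
Qed.
End CyclicWeights.

(** * Codegrees and blow-ups *)

Lemma set_degreeE (k : nat) (T : finType) (H : {set {set T}}) (S : {set T}) :
  (0 < k)%N -> kgraph k H -> #|S| = k.-1 ->
  set_degree H S = #|[set v | (v \notin S) && (v |: S \in H)]|.
Proof.
move=> k0 Hk Sk.
rewrite -(@card_in_imset _ _ (fun v => v |: S)) => [|u v]; last first.
  rewrite !inE => /andP [uS _] /andP [vS _] /setP /(_ u).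
  by rewrite !in_setU1 eqxx (negPf uS) !orbF => /esym /eqP.
rewrite /set_degree; apply: eq_card => e; rewrite inE; apply/andP/imsetP => [[eH Se]|[v]].
  have : #|e :\: S| == 1%N by rewrite cardsDS // (Hk e eH) Sk; lia.
  case/cards1P => v eE.
  have vE : v |: S = e.
    by rewrite -[RHS](setID e S) (setIidPr Se) eE setUC.
  exists v => //; rewrite inE vE eH andbT.
  by have : v \in e :\: S; [rewrite eE set11 | rewrite inE => /andP []].
by rewrite inE => /andP [_ vH] ->; split => //; apply: subsetUr.
Qed.

Lemma exists_set_card (T : finType) (j : nat) :
  (j <= #|T|)%N -> exists S : {set T}, #|S| = j.
Proof.
move=> jT; have : (0 < #|[set S : {set T} | S \subset [set: T] & #|S| == j]|)%N.
  by rewrite cards_draws cardsT bin_gt0.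
by case/card_gt0P => S; rewrite inE => /andP [_ /eqP]; exists S.
Qed.

Lemma min_degree_ge (j b : nat) (T : finType) (H : {set {set T}}) :
  (j <= #|T|)%N -> (forall S : {set T}, #|S| = j -> (b <= set_degree H S)%N) ->
  (b <= min_degree j H)%N.
Proof.
move=> jT bH; rewrite /min_degree; apply: (big_ind (fun m => b <= m)%N) => [||S /eqP].
(* The default value [#|H|] needs the bound too; it is at least the degree of any set of size
   [j]. *)
- have [S Sj] := exists_set_card jT; apply: (leq_trans (bH S Sj)).
  by apply: subset_leq_card; apply/subsetP => e; rewrite inE => /andP [].
- by move=> m n bm bn; rewrite leq_min bm.
exact: bH.
Qed.

Lemma min_degree_le (k : nat) (T : finType) (H : {set {set T}}) :
  (0 < k <= #|T|)%N -> kgraph k H -> (min_degree k.-1 H <= #|T|)%N.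
Proof.
move=> /andP [k0 kT] Hk.
have [S Sk] := exists_set_card (leq_trans (leq_pred k) kT).
apply: (@leq_trans (set_degree H S)).
  rewrite /min_degree; elim: (index_enum _) (mem_index_enum S) => [//|S' r IH].
  rewrite big_cons in_cons => /orP [/eqP <-|/IH le_r].
    by rewrite Sk eqxx geq_minl.
  by case: ifP => // _; rewrite geq_min le_r orbT.
by rewrite (set_degreeE k0 Hk Sk) max_card.
Qed.

(** The density 1 forces decompositions vacuously, as the minimum codegree is at most [#|T|]. So the
    infimum is not the default value 0 of an empty set. *)
Lemma cycle_threshold_ge (R : realType) (k l : nat) (b : R) : (0 < k)%N ->
  (forall d : R, forces_decomposition k l d -> b <= d) ->
  b <= cycle_threshold R k l.
Proof.
move=> k0 hb; apply: lb_le_inf => //; exists 1; split=> // eps eps0.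
exists k => T H kT Hk _ hdeg.
have /(min_degree_le (k := k)) /(_ Hk) := introT andP (conj k0 kT).
rewrite -(ler_nat R) => /(le_trans hdeg).
have : 0 < #|T|%:R :> R by rewrite ltr0n (leq_trans k0).
by move=> T0; rewrite -[leRHS]mul1r ler_pM2r //; lra.
Qed.

Lemma sum_vertex_degree (k : nat) (T : finType) (H : {set {set T}}) :
  kgraph k H -> (\sum_v vertex_degree H v = k * #|H|)%N.
Proof.
move=> Hk; rewrite mulnC -sum_nat_const.
rewrite (eq_bigr (fun v => \sum_(e in H) (v \in e)))%N; last first.
  move=> v _; rewrite -big_mkcondr sum1_card.
  by apply: eq_card => e; rewrite !inE.
rewrite exchange_big; apply: eq_bigr => e eH; rewrite -(Hk e eH) -sum1_card [RHS]big_mkcond.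
by apply: eq_bigr => v _; case: (v \in e).
Qed.

Section Blowup.
Variables (T C : finType) (cl : T -> C).

Definition class (c : C) : {set T} := [set x | cl x == c].

Definition same_profile (e e' : {set T}) : Prop :=
  forall c, #|e :&: class c| = #|e' :&: class c|.

Lemma same_profile_sum (V : nmodType) (phi : C -> V) (e e' : {set T}) :
  same_profile e e' -> \sum_(x in e) phi (cl x) = \sum_(x in e') phi (cl x).
Proof.
have E (d : {set T}) : \sum_(x in d) phi (cl x) = \sum_c phi c *+ #|d :&: class c|.
  rewrite (partition_big cl xpredT) //=; apply: eq_bigr => c _.
  rewrite (eq_bigr (fun=> phi c)) => [|x /andP [_ /eqP ->]] //.
  by rewrite sumr_const; congr (_ *+ _); apply: eq_card => x; rewrite !inE.
by move=> ee'; rewrite !E; apply: eq_bigr => c _; rewrite ee'.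
Qed.

(* Fix a vertex v and group the edges at v by a second class c that they meet
   and by their part R outside c: each group consists of all sets R :|: J with
   J in c of a given positive size, so its size is a binomial coefficient. *)
Lemma blowup_degree (k M : nat) (H : {set {set T}}) (v : T) :
  (forall c, (M * k`! %| #|class c|)%N) -> kgraph k H ->
  (forall e e', e \in H -> same_profile e e' -> e' \in H) ->
  (forall e, e \in H -> forall c, ~~ (e \subset class c)) ->
  (M %| vertex_degree H v)%N.
Proof.
move=> Mcl Hk Hsym Hmono.
(* In j C(n, j) = n C(n - 1, j - 1) with n divisible by M k!, the factor j cancels against k! and M
   survives. *)
have bin_dvd c j : (0 < j <= k)%N -> (M %| 'C(#|class c|, j))%N.
  case: j => // j /andP [_ jk]; have /dvdnP [q ->] := Mcl c.
  case: (posnP (q * (M * k`!))) => [->|n0]; first by rewrite bin0n dvdn0.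
  have /dvdnP [a kE] : (j.+1 %| k`!)%N by rewrite dvdn_fact.
  have := mul_bin_diag (q * (M * k`!)) j; set b := 'C(_.-1, j) => e.
  suff -> : 'C(q * (M * k`!), j.+1) = (M * (q * a * b))%N by exact: dvdn_mulr.
  by apply/eqP; rewrite -(eqn_pmul2l (ltn0Sn j)) -e; apply/eqP; rewrite [in LHS]kE; ring.
(* [pk] reads the second class off the profile of the edge alone, so exchanging J for a set of the
   same size in that class keeps it. *)
pose pk (e : {set T}) := [pick c | (c != cl v) && (0 < #|e :&: class c|)%N].
pose key (e : {set T}) := (pk e, if pk e is Some c then e :\: class c else e).
have -> : vertex_degree H v = (\sum_(e | (e \in H) && (v \in e)) 1)%N.
  by rewrite sum1_card; apply: eq_card => e; rewrite !inE.
rewrite (partition_big key xpredT) //=; elim/big_ind: _ => [//|a b|p _].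
  exact: dvdn_add.
have [e0 /andP [/andP [e0H ve0] /eqP e0p]|none] :=
    pickP (fun e => ((e \in H) && (v \in e)) && (key e == p)); last first.
  by rewrite big_pred0.
have : exists c, pk e0 = Some c.
  rewrite /pk; case: pickP => [c _|no]; first by exists c.
  case/negP: (Hmono e0 e0H (cl v)); apply/subsetP => x xe0.
  rewrite inE; apply: contraFT (no (cl x)) => ->; rewrite card_gt0.
  by apply/set0Pn; exists x; rewrite !inE xe0 /=.
case=> c pkc; pose Rs := e0 :\: class c.
have [cv c0] : c != cl v /\ (0 < #|e0 :&: class c|)%N.
  by move: pkc; rewrite /pk; case: pickP => // c' /andP [? ?] [<-].
have pE : p = (Some c, Rs) by rewrite -e0p /key pkc.
have RJ (J : {set T}) : J \subset class c ->
    (Rs :|: J) :&: class c = J /\ (Rs :|: J) :\: class c = Rs.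
  move=> /subsetP Jc; split; apply/setP => x; rewrite !inE;
  by have := Jc x; rewrite inE; case: (x \in J) => [/(_ isT) ->|_];
    case: (cl x == c); rewrite ?andbF ?andbT ?orbF.
rewrite sum1_card.
suff -> : #|[pred e | ((e \in H) && (v \in e)) && (key e == p)]| =
    'C(#|class c|, #|e0 :&: class c|).
  by apply: bin_dvd; rewrite c0 /= -(Hk _ e0H) subset_leq_card // subsetIl.
rewrite -cards_draws -(@card_in_imset _ _ (fun J => Rs :|: J)) => [|J K]; last first.
  rewrite !inE => /andP [/RJ [JE _] _] /andP [/RJ [KE _] _] JK.
  by rewrite -JE JK KE.
apply: eq_card => e; rewrite inE; apply/andP/imsetP => [[/andP [eH ve]] /eqP eE|[J]].
  have {}eE : pk e = Some c /\ e :\: class c = Rs.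
    by move: eE; rewrite pE /key; case: (pk e) => // c' [-> ->].
  have eRJ : e = Rs :|: (e :&: class c) by rewrite -eE.2 setUC setID.
  exists (e :&: class c) => //; rewrite inE subsetIr /=.
  have := cardsID (class c) e; have := cardsID (class c) e0.
  by rewrite eE.2 -/Rs (Hk _ eH) (Hk _ e0H) => <- /addIn ->.
rewrite inE => /andP [Jc /eqP Jk] ->; have [JI JD] := RJ J Jc.
have prof : same_profile e0 (Rs :|: J).
  move=> c'; have [->|c'c] := eqVneq c' c; first by rewrite JI Jk.
  congr #|pred_of_set _|; apply/setP => x; rewrite !inE.
  have := subsetP Jc x; rewrite inE.
  case: (eqVneq (cl x) c') => [->|_]; last by rewrite !andbF.
  by rewrite (negPf c'c) /=; case: (x \in J) => [/(_ isT) //|_]; rewrite orbF.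
have pkJ : pk (Rs :|: J) = Some c.
  by rewrite -pkc; apply: eq_pick => c' /=; rewrite prof.
rewrite (Hsym _ _ e0H prof) pE /key pkJ JD eqxx; split=> //.
by rewrite !inE ve0 eq_sym cv.
Qed.

(** Degrees divisible by [k * l] also settle the edge count: they sum to [k * #|H|], whence [l]
    divides [#|H|]. *)
Lemma blowup_divisible (k l : nat) (H : {set {set T}}) :
  (0 < k)%N -> (forall c, (k * l * k`! %| #|class c|)%N) -> kgraph k H ->
  (forall e e', e \in H -> same_profile e e' -> e' \in H) ->
  (forall e, e \in H -> forall c, ~~ (e \subset class c)) ->
  cycle_divisible k l H.
Proof.
move=> k0 Mcl Hk Hsym Hmono.
have deg v := blowup_degree v Mcl Hk Hsym Hmono.
split=> [|v]; last exact: dvdn_trans (dvdn_mulr l (dvdnn k)) (deg v).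
by rewrite -(dvdn_pmul2l k0) -(sum_vertex_degree Hk); apply: dvdn_sum.
Qed.
End Blowup.

(** * An invariant of two-coloured triples *)

Section TwoColouredTriples.
Variables (T : finType) (col : T -> 'I_3).

Definition colour_count (d : nat) (e : {set T}) : nat :=
  (\sum_(x in e) (col x == d :> nat))%N.

(** The colours 0, 1, 2 stand for A, B, C; this is the contribution of one edge to the invariant
    modulo 3. *)
Definition invariant01 (e : {set T}) : nat :=
  if colour_count 2 e == 0%N then colour_count 1 e else 0%N.

Let F (u v w : nat) : nat :=
  if ((u == 2) + (v == 2) + (w == 2) == 0)%N
  then ((u == 1) + (v == 1) + (w == 1))%N else 0%N.

Let g (u v : nat) : nat :=
  if ((u == 2) + (v == 2) == 0)%N then (2 * (u == 1) + (v == 1))%N else 0%N.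

(** Without colour 2 the left side is 3 [u = 1] + 2 [v = 1] + [w = 1]. With colour 2, one of the
    colours 0 and 1 is missing, and [g] takes only the values 0 and [g 1 1 = 3]. *)
Let F_coboundary (u v w d : nat) : (u < 3)%N -> (v < 3)%N -> (w < 3)%N ->
  (d < 3)%N -> u != d -> v != d -> w != d -> F u v w + g u v = g v w %[mod 3].
Proof.
by case: u => [|[|[|u]]] //; case: v => [|[|[|v]]] //; case: w => [|[|[|w]]] //;
  case: d => [|[|[|d]]].
Qed.

(* On triples missing some colour, [invariant01] summed along a tight walk
   telescopes modulo 3. *)
Lemma two_coloured_sum (l : nat) (H : {set {set T}}) : (3 < l)%N ->
  (forall e, e \in H -> exists d : 'I_3, colour_count d e = 0%N) ->
  cycle_decomposable 3 l H -> (3 %| \sum_(e in H) invariant01 e)%N.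
Proof.
move=> l3 Hcol; apply: (@decomposable_sum nat 3 l T H invariant01 (fun n => 3 %| n)%N) => //.
  by move=> a b; exact: dvdn_add.
move=> y yinj yH.
have l0 : (0 < l)%N by apply: leq_trans l3.
pose x n := col (y (cyc l0 n)).
have xl n : x (n + l)%N = x n.
  by rewrite /x (_ : cyc l0 (n + l) = cyc l0 n) //; apply: val_inj; rewrite /= modnDr.
have cnt d (i : 'I_l) : colour_count d (y @: tight_edge 3 i) =
    ((x i == d :> nat) + (x i.+1 == d :> nat) + (x i.+2 == d :> nat))%N.
  rewrite /colour_count big_imset /=; last by move=> ? ? _ _; exact: yinj.
  rewrite (sum_tight_edge l0 (fun j => (col (y j) == d :> nat) : nat) i) 1?ltnW //.
  by rewrite !big_ord_recl big_ord0 /x /= addr0 addrA addn0 addn1 addn2.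
have FE (i : 'I_l) : (invariant01 (y @: tight_edge 3 i) +
    g (x i) (x i.+1) = g (x i.+1) (x i.+2) %[mod 3])%N.
  have [d dE] := Hcol _ (yH i); rewrite /invariant01 !cnt.
  have /andP [/andP [? ?] ?] : (x i != d) && (x i.+1 != d) && (x i.+2 != d).
    by move/eqP: dE; rewrite cnt !addn_eq0 !eqb0.
  exact: (@F_coboundary (x i) (x i.+1) (x i.+2) d).
have gper n : g (x (n + l)) (x (n + l).+1) = g (x n) (x n.+1) by rewrite -addSn !xl.
have := @sum_shift nat l (fun n => g (x n) (x n.+1)) 1 gper.
set G := \sum_(i < l) g (x i) (x i.+1) => GE.
have : (\sum_(i < l) invariant01 (y @: tight_edge 3 i) + G = 0 + G %[mod 3])%N.
  rewrite add0n -[in RHS]GE -big_split /=.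
  apply: (big_ind2 (fun a b => a = b %[mod 3])) => [//|a b c d ab cd|i _].
    by rewrite -modnDm ab cd modnDm.
  by rewrite FE.
by move/eqP; rewrite eqn_modDr mod0n.
Qed.
End TwoColouredTriples.

Lemma sum_set3 (V : nmodType) (T : finType) (x y z : T) (phi : T -> V) :
  x != y -> x != z -> y != z ->
  \sum_(t in x |: [set y; z]) phi t = phi x + (phi y + phi z).
Proof.
move=> xy xz yz; rewrite big_setU1 ?inE ?negb_or ?xy //=.
by rewrite big_setU1 ?inE //= big_set1.
Qed.

(** * Exchanging two edges *)

Section Swap.
Variables (T : finType) (H : {set {set T}}) (x1 x2 y1 y2 : {set T}).
Hypotheses (x12 : x1 != x2) (y12 : y1 != y2).
Hypotheses (x1H : x1 \in H) (x2H : x2 \in H) (y1H : y1 \notin H) (y2H : y2 \notin H).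

Definition swap : {set {set T}} := y1 |: (y2 |: (H :\ x1 :\ x2)).

(** Constant [W] compares edge counts, incidence with a vertex compares degrees, and [invariant01]
    detects the change modulo 3. *)
Lemma swap_sum (W : {set T} -> nat) :
  (\sum_(e in swap) W e + (W x1 + W x2) = \sum_(e in H) W e + (W y1 + W y2))%N.
Proof.
rewrite big_setU1; last by rewrite !inE (negPf y1H) (negPf y12) !andbF.
rewrite big_setU1; last by rewrite !inE (negPf y2H) !andbF.
have -> : (\sum_(e in H) W e = W x1 + (W x2 + \sum_(e in H :\ x1 :\ x2) W e))%N.
  rewrite (big_setD1 x1) //= (big_setD1 x2) // !inE x2H eq_sym x12 //.
by rewrite /=; lia.
Qed.

Lemma swap_divisible (k l : nat) :
  (forall v, (v \in x1) + (v \in x2) = (v \in y1) + (v \in y2))%N ->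
  cycle_divisible k l H -> cycle_divisible k l swap.
Proof.
move=> xyv [lH kH]; split.
  have := swap_sum (fun=> 1%N); rewrite !sum1_card => /addIn ->; exact: lH.
move=> v; have := swap_sum (fun e => (v \in e) : nat); rewrite xyv => /addIn.
have E (K : {set {set T}}) : vertex_degree K v = (\sum_(e in K) (v \in e))%N.
  rewrite -big_mkcondr sum1_card; by apply: eq_card => e; rewrite !inE.
by rewrite -!E => ->.
Qed.

Lemma swap_set_degree (S : {set T}) :
  (set_degree H S <= set_degree swap S + 2)%N.
Proof.
have /subset_leq_card : [set e in H | S \subset e] \subset
    [set e in swap | S \subset e] :|: [set x1; x2].
  apply/subsetP => e; rewrite !inE => /andP [-> ->].
  by case: (e == x1); case: (e == x2); rewrite ?orbT.
move/leq_trans; apply; apply: leq_trans (leq_card_setU _ _) _.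
by rewrite cards2 leq_add2l; case: (_ != _).
Qed.

Lemma swap_kgraph (k : nat) :
  #|y1| = k -> #|y2| = k -> kgraph k H -> kgraph k swap.
Proof.
by move=> y1k y2k Hk e; rewrite !inE => /or3P [/eqP ->|/eqP ->|/and3P [_ _ /Hk]].
Qed.
End Swap.

(** * A tripartite 3-graph of codegree near two thirds *)

Section TripartiteConstruction.
Variables (l q s : nat).
Hypotheses (l3 : (3 < l)%N) (s2 : (1 < s)%N) (sl : (3 * l * 3`! %| s)%N).

Let T : finType := ('I_3 * 'I_q.+1 * 'I_s)%type.
Let col (x : T) : 'I_3 := x.1.1.
Let cnt (d : nat) (e : {set T}) : nat := colour_count col d e.
Let zeros (e : {set T}) : nat := (\sum_(x in e) (x.1.2 == ord0))%N.

(* The triples of exactly two colours, except that among the vertices of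
   label 0 those with a single vertex of colour 0 are left out.  This makes
   room for a swap of two edges that preserves all degrees, but not
   [invariant01] modulo 3. *)
Definition bicoloured : {set {set T}} :=
  [set e : {set T} | [&& #|e| == 3%N, [exists d : 'I_3, cnt d e == 0%N],
    [forall d : 'I_3, cnt d e != 3%N] & ~~ ((zeros e == 3%N) && (cnt 0 e == 1%N))]].

Let cl (x : T) : 'I_3 * 'I_q.+1 := x.1.

Let bicoloured_kgraph : kgraph 3 bicoloured.
Proof. by move=> e; rewrite inE => /and4P [/eqP]. Qed.

Let bicoloured_divisible : cycle_divisible 3 l bicoloured.
Proof.
apply: (@blowup_divisible _ _ cl) => //.
- move=> c; suff -> : #|class cl c| = s by [].
  have -> : class cl c = setX [set c] [set: 'I_s].
    by apply/setP => -[x y]; rewrite !inE andbT.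
  by rewrite cardsX cards1 cardsT card_ord mul1n.
- move=> e e' + prof; rewrite !inE.
  have cntE d : cnt d e = cnt d e'.
    exact: (@same_profile_sum _ _ cl nat (fun c => c.1 == d :> nat) _ _ prof).
  have zE : zeros e = zeros e'.
    exact: (@same_profile_sum _ _ cl nat (fun c => c.2 == ord0) _ _ prof).
  have cardE : #|e| = #|e'|.
    by rewrite -!sum1_card; exact: (@same_profile_sum _ _ cl nat (fun=> 1%N) _ _ prof).
  rewrite cardE zE cntE => /and4P [-> /existsP [d dE] /forallP h ->].
  rewrite andbT /=; apply/andP; split; first by apply/existsP; exists d; rewrite -cntE.
  by apply/forallP => d'; rewrite -cntE.
move=> e + c; rewrite inE => /and4P [/eqP e3 _ /forallP h _].
apply/negP => /subsetP ec; case/negP: (h c.1); apply/eqP; apply: etrans e3; rewrite -sum1_card.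
by apply: eq_bigr => x /ec; rewrite inE => /eqP <-; rewrite eqxx.
Qed.

Let other_colour (c c' : 'I_3) : 
  exists d : 'I_3, (c != d :> nat) && (c' != d :> nat).
Proof.
have : (0 < #|~: [set c; c']|)%N.
  by have := cardsC [set c; c']; rewrite card_ord cards2; case: (_ != _) => /=; lia.
by case/card_gt0P => d; rewrite !inE negb_or eq_sym (eq_sym d); exists d.
Qed.

(** One colour is excluded for a third vertex: that of the pair if it is monochromatic, otherwise
    the colour missing from it. Label 0 is avoided because of the triples left out. Two colours and
    [q] labels remain, minus the pair itself. *)
Let bicoloured_degree (S : {set T}) : #|S| = 2%N ->
  (2 * q * s - 2 <= set_degree bicoloured S)%N.
Proof.
move=> S2; rewrite (@set_degreeE 3) //.
move/eqP: (S2) => /cards2P [x [y [xy SE]]].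
have [d [dxy dS]] : exists d : 'I_3, (col x = col y -> d = col x) /\
    (col x <> col y -> (col x != d :> nat) && (col y != d :> nat)).
  have [e|ne] := eqVneq (col x) (col y); first by exists (col x).
  have [d dP] := other_colour (col x) (col y).
  by exists d; split => // e; rewrite e eqxx in ne.
pose N : {set T} := [set v | (col v != d) && (v.1.2 != ord0)].
have Ncard : #|N| = (2 * q * s)%N.
  have -> : N = setX (setX [set~ d] [set~ ord0]) [set: 'I_s].
    by apply/setP => -[[a b] c]; rewrite !inE andbT.
  by rewrite !cardsX !cardsC1 cardsT !card_ord.
rewrite -{1}Ncard -{1}S2; apply: (@leq_trans #|N :\: S|).
  by rewrite leq_subLR -(cardsID S N) leq_add2r subset_leq_card // subsetIr.
apply: subset_leq_card; apply/subsetP => v; rewrite !inE => /and3P [vS vd v0].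
have {}vd : col v != d :> nat by [].
rewrite vS /=; move: vS; rewrite SE !inE negb_or => /andP [vx vy].
have E (phi : T -> nat) : (\sum_(t in v |: [set x; y]) phi t = phi v + (phi x + phi y))%N.
  exact: sum_set3.
rewrite -sum1_card !/(cnt _ _) /zeros !E (negPf v0) /=.
apply/and3P; split.
- have [exy|/eqP ne] := eqVneq (col x) (col y).
    have [d' /andP [d1 d2]] := other_colour (col x) (col v).
    by apply/existsP; exists d'; rewrite /cnt /colour_count E -exy (negPf d1) (negPf d2).
  have /andP [d1 d2] := dS ne.
  by apply/existsP; exists d; rewrite /cnt /colour_count E (negPf d1) (negPf d2) (negPf vd).
- apply/forallP => d'; rewrite /cnt /colour_count E.
  have [exy|/eqP ne] := eqVneq (col x) (col y).
    move: vd; rewrite (dxy exy) -exy.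
    have [<- /negPf -> //|_ _] := eqVneq (nat_of_ord (col x)) d'.
    by case: (col v == d' :> nat).
  have : ~~ ((col x == d' :> nat) && (col y == d' :> nat)).
    by apply/negP => /andP [/eqP e1 /eqP e2]; apply: ne; apply: val_inj;
      exact: etrans e1 (esym e2).
  by case: (col x == _ :> nat); case: (col y == _ :> nat); case: (col v == _ :> nat).
by case: (x.1.2 == _); case: (y.1.2 == _).
Qed.

(** [bicoloured] and its swap are both divisible, but their sums of [invariant01] differ by 1, so
    they are not both decomposable. The codegree loses 2 to the pair and 2 to the swap. *)
Lemma not_forced_below_two_thirds : exists H : {set {set T}},
  [/\ kgraph 3 H, cycle_divisible 3 l H, ~ cycle_decomposable 3 l H
    & forall S : {set T}, #|S| = 2%N -> (2 * q * s - 4 <= set_degree H S)%N].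
Proof.
pose V (c : 'I_3) (b : bool) : T :=
  (c, ord0, if b then Ordinal s2 else Ordinal (ltnW s2)).
pose c0 := @Ordinal 3 0 isT; pose c1 := @Ordinal 3 1 isT; pose c2 := @Ordinal 3 2 isT.
have V_neq c b c' b' : (c != c') || (b != b') -> V c b != V c' b'.
  apply: contraTN => /eqP [-> /eqP]; rewrite eqxx /=.
  by case: b; case: b'.
(* Interchanging [V c0 false] and [V c1 false] turns [x1], [x2] into [y1], [y2]. All labels are 0,
   so [y1] and [y2], with one vertex of colour 0 each, are left out of [bicoloured]. The invariants
   are 1, 0 before and 2, 0 after. *)
pose x1 := V c0 false |: [set V c0 true; V c1 true].
pose x2 := V c1 false |: [set V c2 false; V c2 true].
pose y1 := V c1 false |: [set V c0 true; V c1 true].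
pose y2 := V c0 false |: [set V c2 false; V c2 true].
have E (v w z : T) (phi : T -> nat) : v != w -> v != z -> w != z ->
    (\sum_(t in v |: [set w; z]) phi t = phi v + (phi w + phi z))%N.
  exact: sum_set3.
have E1 phi : (\sum_(t in x1) phi t =
    phi (V c0 false) + (phi (V c0 true) + phi (V c1 true)))%N.
  by apply: E; apply: V_neq.
have E2 phi : (\sum_(t in x2) phi t =
    phi (V c1 false) + (phi (V c2 false) + phi (V c2 true)))%N.
  by apply: E; apply: V_neq.
have F1 phi : (\sum_(t in y1) phi t =
    phi (V c1 false) + (phi (V c0 true) + phi (V c1 true)))%N.
  by apply: E; apply: V_neq.
have F2 phi : (\sum_(t in y2) phi t =
    phi (V c0 false) + (phi (V c2 false) + phi (V c2 true)))%N.
  by apply: E; apply: V_neq.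
have card (e : {set T}) : #|e| = (\sum_(t in e) 1)%N by rewrite sum1_card.
have x1H : x1 \in bicoloured.
  rewrite inE card /cnt /colour_count /zeros !E1 /=; apply/and3P; split=> //.
    by apply/existsP; exists c2; rewrite E1.
  by apply/forallP => -[[|[|[|d]]] dlt]; rewrite E1.
have x2H : x2 \in bicoloured.
  rewrite inE card /cnt /colour_count /zeros !E2 /=; apply/and3P; split=> //.
    by apply/existsP; exists c0; rewrite E2.
  by apply/forallP => -[[|[|[|d]]] dlt]; rewrite E2.
have y1H : y1 \notin bicoloured.
  by rewrite inE /cnt /colour_count /zeros !F1 /= !andbF.
have y2H : y2 \notin bicoloured.
  by rewrite inE /cnt /colour_count /zeros !F2 /= !andbF.
have neq (e e' : {set T}) d : cnt d e != cnt d e' -> e != e'.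
  by apply: contraNneq => ->.
have x12 : x1 != x2 by apply: (neq _ _ 0%N); rewrite /cnt /colour_count E1 E2.
have y12 : y1 != y2 by apply: (neq _ _ 1%N); rewrite /cnt /colour_count F1 F2.
have xyv v : ((v \in x1) + (v \in x2) = (v \in y1) + (v \in y2))%N.
  have memE (e : {set T}) : (v \in e : nat) = (\sum_(t in e) (t == v))%N.
    case: (boolP (v \in e)) => ve.
      rewrite (big_setD1 v) //= eqxx big1 // => t.
      by rewrite !inE => /andP [/negPf ->].
    by rewrite big1 // => t te; case: eqP => // tv; rewrite -tv te in ve.
  by rewrite !memE E1 E2 F1 F2 addnACA (addnC (_ == v)) addnACA.
have Hk : kgraph 3 (swap bicoloured x1 x2 y1 y2).
  by apply: swap_kgraph => //; rewrite card ?F1 ?F2.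
have [dec|] := pselect (cycle_decomposable 3 l bicoloured); last first.
  exists bicoloured; split => // S S2; apply: leq_trans (bicoloured_degree S2).
  by rewrite leq_sub2l.
exists (swap bicoloured x1 x2 y1 y2); split => //.
- exact: swap_divisible.
- have H0 (e : {set T}) : e \in bicoloured -> exists d : 'I_3, colour_count col d e = 0%N.
    by rewrite inE => /and4P [_ /existsP [d /eqP ?] _ _]; exists d.
  have H1 (e : {set T}) : e \in swap bicoloured x1 x2 y1 y2 ->
      exists d : 'I_3, colour_count col d e = 0%N.
    rewrite !inE => /or3P [/eqP ->|/eqP ->|/and3P [_ _ eH]].
    + by exists c2; rewrite /colour_count F1.
    + by exists c1; rewrite /colour_count F2.
    by apply: H0; rewrite inE.
  move/(two_coloured_sum l3 H1); have := two_coloured_sum l3 H0 dec.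
  have := swap_sum x12 y12 x1H x2H y1H y2H (invariant01 col).
  rewrite /invariant01 /colour_count !E1 !E2 !F1 !F2 /=.
  move: (\sum_(e in bicoloured) _)%N (\sum_(e in swap _ _ _ _ _) _)%N => a b.
  by clear; lia.
move=> S S2; have := swap_set_degree bicoloured x1 x2 y1 y2 S.
by have := bicoloured_degree S2; lia.
Qed.
End TripartiteConstruction.

Lemma two_thirds_le (R : realType) (l : nat) (d : R) : (3 < l)%N ->
  forces_decomposition 3 l d -> 2 / 3 <= d.
Proof.
move=> l3 [d0 hd]; rewrite leNgt; apply/negP => dlt.
pose eps := (2 / 3 - d) / 2.
have eps0 : 0 < eps by rewrite /eps; lra.
have [n0 hn0] := hd eps eps0.
(* The codegree falls short of two thirds of the vertices by at most [2 s + 4 <= 4 s]. As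
   [eps q > 2], this is below [3 eps q s], and [d + eps = 2 / 3 - eps]. *)
pose s := (3 * l * 3`!)%N; pose q := maxn n0 (Num.bound (2 / eps)).
have s2 : (1 < s)%N by rewrite /s (_ : 3`! = 6)%N //; lia.
have sdvd : (3 * l * 3`! %| s)%N by exact: dvdnn.
clearbody s.
have [H [Hk Hdiv Hndec Hdeg]] := @not_forced_below_two_thirds l q s l3 s2 sdvd.
apply: Hndec; apply: hn0 => //.
  rewrite !card_prod !card_ord; have : (n0 <= q)%N by exact: leq_maxl.
  by move: (s2) => ?; nia.
have := @min_degree_ge 2 (2 * q * s - 4) _ H _ Hdeg.
rewrite !card_prod !card_ord => /(_ _)/wrap[].
  by move: (s2) => ?; nia.
rewrite -(ler_nat R); apply: le_trans.
have q2 : 2 / eps < q%:R.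
  apply: (@lt_le_trans _ _ (Num.bound (2 / eps))%:R).
    by apply: archi_boundP; rewrite divr_ge0 // ltW.
  by rewrite ler_nat leq_maxr.
have q0 : (0 < q)%N.
  by rewrite -(ltr_nat R); apply: lt_trans q2; rewrite divr_gt0.
have : 2 < eps * q%:R by rewrite mulrC -ltr_pdivrMr.
have : 2 <= s%:R :> R by rewrite ler_nat.
rewrite !natrM natrB; last by move: (s2) q0 => ? ?; nia.
have -> : d + eps = 2 / 3 - eps by rewrite /eps; lra.
rewrite !natrM -(natr1 q).
move=> s2' eq2.
have : 2 * s%:R <= eps * q%:R * s%:R by rewrite ler_wpM2r // ltW.
have : 0 <= eps * s%:R by rewrite mulr_ge0 // ltW.
lra.
Qed.

(** * Counting sets by tuples *)

(** [n ^_ j] counts injective tuples; repeated entries are thus a lower-order error when sums over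
    sets become sums over tuples. *)
Lemma expn_ffact_le (n j : nat) : (n ^ j <= n ^_ j + j ^ 2 * n ^ j.-1)%N.
Proof.
elim: j => [//|j IH] /=; rewrite expnS ffactnSr.
have : (n * n ^ j <= n * n ^_ j + j ^ 2 * n ^ j)%N.
  case: j IH => [|j] IH; first by rewrite !expn0 ffactn0; lia.
  by rewrite [(n ^ j.+1)%N in X in (_ <= _ + X)%N]expnS mulnCA -mulnDr leq_mul2l IH orbT.
have : (n ^_ j <= n ^ j)%N.
  by elim: (j) => [//|i le]; rewrite ffactnSr expnSr leq_mul // leq_subr.
have : (n * n ^_ j <= n ^_ j * (n - j) + j * n ^_ j)%N.
  by rewrite mulnC (mulnC j) -mulnDr leq_mul2l -leq_subLR orbC; lia.
by nia.
Qed.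

Section TupleCounting.
Variables (R : comRingType) (k : nat) (T : finType).

(** Each [k]-set is the image of [k!] injective tuples. Passing to tuples makes the coordinates
    independent. *)
Lemma sum_injective_ffun (W : {set T} -> R) :
  \sum_(f : {ffun 'I_k -> T} | injectiveb f) W [set f i | i : 'I_k] =
  k`!%:R * \sum_(e : {set T} | #|e| == k) W e.
Proof.
rewrite (partition_big (fun f : {ffun 'I_k -> T} => [set f i | i : 'I_k])
   (fun e : {set T} => #|e| == k)) /=; last first.
  by move=> f /injectiveP finj; rewrite card_imset // card_ord.
rewrite mulr_sumr; apply: eq_bigr => e /eqP ek.
rewrite (eq_bigr (fun=> W e)) => [|f /andP [_ /eqP ->]] //.
rewrite sumr_const mulr_natl; congr (_ *+ _).
have -> : k`! = (#|e| ^_ #|'I_k|)%N by rewrite ek card_ord ffactnn.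
rewrite -card_inj_ffuns_on.
apply: eq_card => f; rewrite [LHS]unfold_in inE [RHS]andbC.
case: (boolP (injectiveb f)) => [/injectiveP finj|]; rewrite ?andbF ?andbT //.
apply/eqP/ffun_onP => [<- i|fe]; first exact: imset_f.
apply/eqP; rewrite eqEcard card_imset // card_ord ek leqnn andbT.
by apply/subsetP => x /imsetP [i _ ->].
Qed.

Lemma card_noninjective_ffun :
  (#|[set f : {ffun 'I_k -> T} | ~~ injectiveb f]| <= k ^ 2 * #|T| ^ k.-1)%N.
Proof.
have := cardsC [set f : {ffun 'I_k -> T} | injectiveb f].
rewrite card_inj_ffuns card_ffun !card_ord => E.
have -> : [set f : {ffun 'I_k -> T} | ~~ injectiveb f] =
    ~: [set f : {ffun 'I_k -> T} | injectiveb f] by apply/setP => f; rewrite !inE.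
by have := expn_ffact_le #|T| k; lia.
Qed.

Lemma card_ffun_in_class (C : finType) (cl : T -> C) (s : nat) :
  (forall c, #|class cl c| = s) ->
  (#|[set f : {ffun 'I_k -> T} | [exists c, [forall i, cl (f i) == c]]]|
     <= #|C| * s ^ k)%N.
Proof.
move=> cls; have -> : (#|C| * s ^ k)%N =
    (\sum_(c : C) #|[set f : {ffun 'I_k -> T} in ffun_on (mem (class cl c))]|)%N.
  rewrite (eq_bigr (fun=> s ^ k)%N) ?sum_nat_const // => c _.
  by rewrite cardsE card_ffun_on card_ord; congr (_ ^ _)%N; exact: cls.
apply: (@leq_trans #|\bigcup_(c : C) [set f : {ffun 'I_k -> T} in ffun_on (mem (class cl c))]|).
  apply: subset_leq_card; apply/subsetP => f; rewrite inE => /existsP [c /forallP fc].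
  by apply/bigcupP; exists c => //; rewrite inE; apply/ffun_onP => i; rewrite inE fc.
apply: (big_ind2 (fun (A : {set {ffun 'I_k -> T}}) n => #|A| <= n)%N) => //.
  by rewrite cards0.
move=> A m B n Am Bn; apply: leq_trans (leq_card_setU A B) _; exact: leq_add.
Qed.

(** As [P] halves [T], each of the [2 ^ k] patterns of positions satisfying [P] is realised by
    [m ^ k] tuples. *)
Lemma sum_ffun_count (P : pred T) (m : nat) (G : nat -> R) :
  #|[pred x | P x]| = m -> #|[pred x | ~~ P x]| = m ->
  \sum_(f : {ffun 'I_k -> T}) G (\sum_i P (f i))%N =
  m%:R ^+ k * \sum_(i < k.+1) 'C(k, i)%:R * G i.
Proof.
move=> Pm Pm'.
rewrite (partition_big (fun f : {ffun 'I_k -> T} => [set i | P (f i)]) xpredT) //=.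
transitivity (\sum_(A : {set 'I_k}) m%:R ^+ k * G #|A|).
  apply: eq_bigr => A _.
  rewrite (eq_bigr (fun=> G #|A|)) => [|f /eqP <-]; last first.
    congr G; rewrite -sum1_card [RHS]big_mkcond /=; apply: eq_bigr => i _.
    by rewrite inE; case: (P (f i)).
  rewrite sumr_const -natrX -[LHS]mulr_natl; congr (_%:R * _).
  pose F (i : 'I_k) := [pred x | P x == (i \in A)].
  rewrite (_ : #|_| = #|(family F : {pred {ffun 'I_k -> T}})|); last first.
    apply: eq_card => f; apply/idP/familyP => [AE i|fF].
      have fA : [set j | P (f j)] = A by exact/eqP.
      by rewrite inE -fA inE.
    change ([set j | P (f j)] == A); apply/eqP.
    by apply/setP => j; have := fF j; rewrite !inE => /eqP.
  rewrite card_family foldrE big_map big_enum /= (eq_bigr (fun=> m)).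
    by rewrite prod_nat_const card_ord.
  move=> i _; case: (boolP (i \in A)) => iA.
    by rewrite -[RHS]Pm; apply: eq_card => x; exact: eqb_id.
  by rewrite -[RHS]Pm'; apply: eq_card => x; exact: eqbF_neg.
rewrite -mulr_sumr; congr (_ * _).
have card_lt (A : {set 'I_k}) : (#|A| < k.+1)%N.
  by rewrite ltnS -[leqRHS]card_ord max_card.
rewrite (partition_big (fun A : {set 'I_k} => Ordinal (card_lt A)) xpredT) //=.
apply: eq_bigr => i _; rewrite (eq_bigr (fun=> G i)) => [|A /eqP <-] //.
rewrite sumr_const -[LHS]mulr_natl; congr (_%:R * _).
transitivity 'C(#|'I_k|, i); last by rewrite card_ord.
by rewrite -card_draws; apply: eq_card => A; rewrite inE.
Qed.
End TupleCounting.

(** * The space barrier *)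

Section SpaceBarrier.
Variables (R : realType) (k l q s r : nat) (eps : bool) (w : nat -> R).
Hypotheses (k2 : (1 < k)%N) (q0 : (0 < q)%N) (rq : (r <= q)%N).

Let T : finType := (bool * 'I_q * 'I_s)%type.
Let cl (x : T) : bool * 'I_q := x.1.
Let side (x : T) : bool := x.1.1.
Let label (x : T) : 'I_q := x.1.2.

Let sides (e : {set T}) : nat := (\sum_(x in e) side x)%N.
Let labels (e : {set T}) : nat := (\sum_(x in e) label x)%N.

(* The k-sets with [sides] of parity [eps], and a fraction r / q of the other
   ones, singled out by the sum of their labels.  Leaving out the sets inside
   a class makes all degrees divisible once the class size s is. *)
Definition parity_graph : {set {set T}} :=
  [set e : {set T} | [&& #|e| == k, [forall c, ~~ (e \subset class cl c)]
    & (odd (sides e) == eps) || (labels e %% q < r)%N]].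

Let card_class c : #|class cl c| = s.
Proof.
have -> : class cl c = setX [set c] [set: 'I_s].
  by apply/setP => -[x y]; rewrite !inE andbT.
by rewrite cardsX cards1 cardsT card_ord mul1n.
Qed.

Lemma parity_graph_kgraph : kgraph k parity_graph.
Proof. by move=> e; rewrite inE => /and3P [/eqP]. Qed.

Lemma parity_graph_divisible :
  (k * l * k`! %| s)%N -> cycle_divisible k l parity_graph.
Proof.
move=> sdvd; apply: (@blowup_divisible _ _ cl); first exact: ltnW.
- by move=> c; rewrite card_class.
- exact: parity_graph_kgraph.
- move=> e e' + prof; rewrite !inE.
  have -> : sides e' = sides e.
    exact/esym/(@same_profile_sum _ _ cl nat (fun c => c.1) _ _ prof).
  have -> : labels e' = labels e.
    exact/esym/(@same_profile_sum _ _ cl nat (fun c => c.2 : nat) _ _ prof).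
  have cardE : #|e| = #|e'|.
    by rewrite -!sum1_card; exact: (@same_profile_sum _ _ cl nat (fun=> 1%N) _ _ prof).
  rewrite cardE => /and3P [-> /forallP h ->]; rewrite andbT /=.
  apply/forallP => c; apply: contra (h c) => ec.
  have := prof c; rewrite (setIidPl ec) -cardE => E.
  by apply/setIidPl/eqP; rewrite eqEcard subsetIl E leqnn.
by move=> e + c; rewrite inE => /and3P [_ /forallP].
Qed.

Let card_label_window b : #|[set j : 'I_q | ((b + j) %% q < r)%N]| = r.
Proof.
have inj : injective (fun j : 'I_q => cyc q0 (b + j)).
  move=> i j /(congr1 val) /= /eqP; rewrite eqn_modDl !modn_small // => /eqP.
  exact: val_inj.
transitivity #|[set j : 'I_q | (j < r)%N]|.
  by rewrite -[RHS](card_preimset _ inj); apply: eq_card => j; rewrite !inE.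
rewrite -[RHS](card_ord r) -!sum1_card [RHS](big_ord_widen q (fun=> 1%N) rq).
by apply: eq_bigl => j; rewrite inE.
Qed.

(** All [q s] vertices on one side give parity [eps], and [r s] on the other side give an admissible
    label sum. Lost are [S] and the class of one of its vertices; avoiding that class keeps the edge
    from lying inside a class. *)
Lemma parity_graph_degree (S : {set T}) : #|S| = k.-1 ->
  ((q + r) * s <= set_degree parity_graph S + s + k.-1)%N.
Proof.
move=> Sk; rewrite (set_degreeE (ltnW k2) parity_graph_kgraph Sk).
have [x xS] : exists x, x \in S by apply/card_gt0P; rewrite Sk; lia.
pose a := odd (sides S) (+) eps.
pose N1 : {set T} := [set v | side v == a].
pose N2 : {set T} := [set v | (side v == ~~ a) && ((labels S + label v) %% q < r)%N].
have N1card : #|N1| = (q * s)%N.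
  have -> : N1 = setX (setX [set a] [set: 'I_q]) [set: 'I_s].
    by apply/setP => -[[b c] d]; rewrite !inE !andbT.
  by rewrite !cardsX cards1 !cardsT !card_ord mul1n.
have N2card : #|N2| = (r * s)%N.
  have -> : N2 = setX (setX [set ~~ a] [set j : 'I_q | ((labels S + j) %% q < r)%N]) [set: 'I_s].
    by apply/setP => -[[b c] d]; rewrite !inE !andbT.
  by rewrite !cardsX cards1 cardsT card_ord card_label_window mul1n.
have N12 : #|N1 :|: N2| = ((q + r) * s)%N.
  rewrite cardsU N1card N2card (_ : N1 :&: N2 = set0) ?cards0 ?subn0 ?mulnDl //.
  by apply/setP => v; rewrite !inE; case: eqP => //= ->; case: (a).
rewrite -N12 -[in leqRHS](card_class (cl x)) -Sk -addnA.
set E := [set v | _].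
have /subset_leq_card : N1 :|: N2 \subset E :|: (class cl (cl x) :|: S).
  apply/subsetP => v vN; rewrite in_setU orbC -implyNb; apply/implyP.
  rewrite in_setU negb_or => /andP [vx vS]; rewrite !inE vS /=.
  have sumE (phi : T -> nat) : (\sum_(t in v |: S) phi t = phi v + \sum_(t in S) phi t)%N.
    by rewrite big_setU1.
  apply/and3P; split.
  - by rewrite cardsU1 vS Sk; lia.
  - apply/forallP => c; apply/negP => /subsetP vSc; move: vx; rewrite inE.
    have := vSc v; rewrite setU11 inE => /(_ isT) /eqP ->.
    have := vSc x; rewrite setU1r // inE => /(_ isT) /eqP ->.
    by rewrite eqxx.
  rewrite /sides /labels !sumE; move: vN; rewrite !inE.
  case: (eqVneq (side v) a) => [-> _|va /= /andP [_ h]].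
    apply/orP; left; rewrite oddD oddb -/(sides S) /a.
    by case: (odd _); case: (eps).
  by apply/orP; right; rewrite addnC.
move/leq_trans; apply; apply: leq_trans (leq_card_setU _ _) _.
by rewrite leq_add2l leq_card_setU.
Qed.

Let fside (f : {ffun 'I_k -> T}) : nat := (\sum_i side (f i))%N.
Let flabel (f : {ffun 'I_k -> T}) : nat := (\sum_i label (f i))%N.

(* Rotating the label of the first vertex equidistributes the label sums. *)
Let sum_label_window (G : nat -> R) :
  q%:R * (\sum_(f | (flabel f %% q < r)%N) G (fside f)) =
  r%:R * \sum_f G (fside f).
Proof.
pose i0 := Ordinal (ltnW k2).
pose turn (a : 'I_q) (f : {ffun 'I_k -> T}) : {ffun 'I_k -> T} :=
  [ffun i => if i == i0 then (side (f i), cyc q0 (a + label (f i)), (f i).2) else f i].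
have turn_inj a : injective (turn a).
  move=> f g /ffunP fg; apply/ffunP => i; have := fg i; rewrite !ffunE.
  case: eqP => // _ e; have e1 := congr1 (fun x : T => x.1.1) e.
  have e2 := congr1 (fun x : T => val x.1.2) e; have e3 := congr1 snd e.
  move: e1 e2 e3; rewrite /side /label; case: (f i) (g i) => -[b c] d [[b' c'] d'] /=.
  move=> -> /eqP + ->; rewrite eqn_modDl !modn_small // => /eqP cc.
  by congr (_, _, _); apply: val_inj.
have turn_side a f : fside (turn a f) = fside f.
  by apply: eq_bigr => i _; rewrite ffunE; case: ifP.
have turn_label a f : (flabel (turn a f) %% q = (flabel f + a) %% q)%N.
  rewrite /flabel (bigD1 i0) //= [in RHS](bigD1 i0) //= ffunE eqxx /= modnDml.
  rewrite (eq_bigr (fun i => label (f i) : nat)) => [|i /negPf ii0].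
    by rewrite -addnA addnC.
  by rewrite ffunE ii0.
transitivity (\sum_(a < q) \sum_f (if ((flabel f + a) %% q < r)%N then G (fside f) else 0)).
  have -> : q%:R = \sum_(a < q) 1 :> R by rewrite sumr_const card_ord.
  rewrite mulr_suml; apply: eq_bigr => a _; rewrite mul1r big_mkcond (reindex_inj (turn_inj a)).
  by apply: eq_bigr => f _; rewrite turn_label turn_side.
rewrite exchange_big mulr_sumr; apply: eq_bigr => f _.
rewrite -big_mkcond sumr_const mulr_natl -[in RHS](card_label_window (flabel f)).
by congr (_ *+ _); apply: eq_card => a; rewrite !inE.
Qed.

Hypotheses (w_ge : forall t, -1 <= w t)
  (w_bad : forall t, odd t != eps -> 0 <= w t).

(** Over all tuples, sides and label sum are independent, so types of the other parity count with
    factor [r / q]. Tuples with repeated entries or inside a class are added back at a cost of at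
    most 1 each, because [w >= -1]. *)
Lemma parity_graph_weight :
  k`!%:R * (\sum_(e in parity_graph) w (sides e)) <=
  (q * s)%:R ^+ k * \sum_(i < k.+1)
     'C(k, i)%:R * (if odd i == eps then w i else r%:R / q%:R * w i)
  + (k ^ 2 * (2 * q * s) ^ k.-1 + 2 * q * s ^ k)%:R.
Proof.
have -> : \sum_(e in parity_graph) w (sides e) =
    \sum_(e : {set T} | #|e| == k) (if e \in parity_graph then w (sides e) else 0).
  rewrite -big_mkcondr; apply: eq_bigl => e; rewrite inE andbC.
  by case: (#|e| == k); rewrite ?andbF //= andbT.
rewrite -(@sum_injective_ffun R k T (fun e => if e \in parity_graph then w (sides e) else 0)).
pose G1 i := if odd i == eps then w i else 0.
pose G2 i := if odd i == eps then 0 else w i.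
pose noninj (f : {ffun 'I_k -> T}) := f \in [set f : {ffun 'I_k -> T} | ~~ injectiveb f].
pose in_class (f : {ffun 'I_k -> T}) :=
  f \in [set f : {ffun 'I_k -> T} | [exists c, [forall i, cl (f i) == c]]].
apply: (@le_trans _ _ (\sum_f (G1 (fside f) +
    (if (flabel f %% q < r)%N then G2 (fside f) else 0) +
    (if noninj f then 1 else 0) + (if in_class f then 1 else 0)))).
  rewrite big_mkcond; apply: ler_sum => f _.
  have G2_ge0 t : 0 <= (if (flabel f %% q < r)%N then G2 t else 0).
    by case: ifP => // _; rewrite /G2; case: ifPn => // /w_bad.
  have G1_ge t : -1 <= G1 t by rewrite /G1; case: ifP => _; [exact: w_ge | lra].
  have tail (b : bool) : 0 <= (if b then 1 else 0) :> R by case: b.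
  have -> : noninj f = ~~ injectiveb f by rewrite /noninj inE.
  case: (boolP (injectiveb f)) => [/injectiveP finj|_] /=; last first.
    have := tail (in_class f); have := G1_ge (fside f); have := G2_ge0 (fside f).
    move: (G1 _) (if (_ < _)%N then _ else _) => x y.
    by move: (if in_class f then _ else _) => z; lra.
  set e := [set f i | i : 'I_k].
  have sumE (phi : T -> nat) : (\sum_(t in e) phi t = \sum_i phi (f i))%N.
    by rewrite big_imset //= => i j _ _; apply: finj.
  have ek : #|e| = k by rewrite card_imset // card_ord.
  have -> : in_class f = [exists c, [forall i, cl (f i) == c]] by rewrite /in_class inE.
  rewrite [e \in _]inE ek eqxx /=.
  case: (boolP [exists c, _]) => [/existsP [c /forallP fc]|nomono].
    have -> : [forall c, ~~ (e \subset class cl c)] = false.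
      apply/negP => /forallP /(_ c) /negP; apply; apply/subsetP => t /imsetP [i _ ->].
      by rewrite inE fc.
    have := G1_ge (fside f); have := G2_ge0 (fside f).
    by move: (G1 _) (if (_ < _)%N then _ else _) => x y /=; lra.
  have -> : [forall c, ~~ (e \subset class cl c)].
    apply/forallP => c; apply: contra nomono => /subsetP ec; apply/existsP; exists c.
    by apply/forallP => i; have := ec (f i); rewrite imset_f // inE => /(_ isT).
  rewrite /= !addr0 /sides /labels !sumE -/(fside f) -/(flabel f) /G1 /G2.
  by case: (odd _ == eps); case: (_ < r)%N; rewrite /= ?addr0 ?add0r.
rewrite !big_split /= -!addrA.
have cardT P : #|[pred x : T | side x == P]| = (q * s)%N.
  rewrite -[LHS]cardsE (_ : [set x : T | side x == P] =
    setX (setX [set P] [set: 'I_q]) [set: 'I_s]); last first.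
    by apply/setP => -[[b c] d]; rewrite !inE !andbT.
  by rewrite !cardsX cards1 !cardsT !card_ord mul1n.
have countE (G : nat -> R) :
    \sum_f G (fside f) = (q * s)%:R ^+ k * \sum_(i < k.+1) 'C(k, i)%:R * G i.
  apply: (@sum_ffun_count R k T side).
    by rewrite -(cardT true); apply: eq_card => x; rewrite !inE eqb_id.
  by rewrite -(cardT false); apply: eq_card => x; rewrite !inE eqbF_neg.
have -> : \sum_f (if (flabel f %% q < r)%N then G2 (fside f) else 0) =
    r%:R / q%:R * ((q * s)%:R ^+ k * \sum_(i < k.+1) 'C(k, i)%:R * G2 i).
  rewrite -big_mkcond -countE mulrAC -sum_label_window.
  by rewrite mulrAC mulfV ?mul1r // pnatr_eq0 -lt0n.
rewrite countE addrA mulrCA -mulrDr mulr_sumr -big_split /=.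
rewrite (eq_bigr (fun i : 'I_k.+1 => 'C(k, i)%:R *
    (if odd i == eps then w i else r%:R / q%:R * w i))); last first.
  by move=> i _; rewrite /G1 /G2; case: ifP => _; ring.
rewrite lerD2l natrD lerD // -big_mkcond sumr_const ler_nat.
  have := card_noninjective_ffun k T; rewrite !card_prod card_bool !card_ord.
  by apply: leq_trans; apply: subset_leq_card; apply/subsetP => f.
have := card_ffun_in_class k card_class; rewrite card_prod card_bool card_ord.
by apply: leq_trans; apply: subset_leq_card; apply/subsetP => f.
Qed.
End SpaceBarrier.

(** With [r] the integer part of [p q], the parity graph has relative codegree about [1 / 2 + p / 2]
    and negative total weight, while tight cycles have nonnegative weight. Here [x] records the
    sides along a cycle. *)
Lemma space_barrier (R : realType) (k l : nat) (eps : bool) (w : nat -> R) (p d : R) :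
  (1 < k)%N -> (k < l)%N -> 0 <= p <= 1 ->
  (forall t, -1 <= w t) -> (forall t, odd t != eps -> 0 <= w t) ->
  (forall x : nat -> nat, (forall i, x (i + l)%N = x i) -> (forall i, (x i <= 1)%N) ->
     0 <= \sum_(i < l) w (\sum_(t < k) x (i + t))%N) ->
  \sum_(i < k.+1) 'C(k, i)%:R * (if odd i == eps then w i else p * w i) < 0 ->
  forces_decomposition k l d -> 1 / 2 + p / 2 <= d.
Proof.
move=> k2 kl /andP [p0 p1] w_ge w_bad w_cyc Wneg [d0 hd].
rewrite leNgt; apply/negP => dlt.
set W := \sum_(i < k.+1) _ in Wneg.
pose e := (1 / 2 + p / 2 - d) / 2.
have e0 : 0 < e by rewrite /e; lra.
have [n0 hn0] := hd e e0.
(* Both constants 3 are error bounds: with m = (q s)^(k - 1), the weight is off by less than 3 s m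
   against -W q s m, and the codegree by at most 3 s against 2 e q s. *)
have [q [q0 qW qe]] : exists q : nat, [/\ (0 < q)%N, 3 <= - W * q%:R & 3 <= 2 * e * q%:R].
  pose a := 3 / - W; pose b := 3 / (2 * e).
  have a0 : 0 <= a by rewrite divr_ge0 // oppr_ge0 ltW.
  have b0 : 0 <= b by rewrite divr_ge0 // mulr_ge0 // ltW.
  have ab : a + b < (Num.bound (a + b))%:R by apply: archi_boundP; rewrite addr_ge0.
  exists (Num.bound (a + b)); split.
  - by rewrite -(ltr_nat R); apply: le_lt_trans ab; rewrite addr_ge0.
  - rewrite mulrC -ler_pdivrMr ?oppr_gt0 //; move: ab b0; rewrite -/a; lra.
  - rewrite mulrC -ler_pdivrMr ?mulr_gt0 //; move: ab a0; rewrite -/b; lra.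
pose r := Num.truncn (p * q%:R).
have pq0 : 0 <= p * q%:R by rewrite mulr_ge0.
have /andP [r_le r_gt] : r%:R <= p * q%:R < r.+1%:R by exact: truncn_itv.
have rq : (r <= q)%N.
  by rewrite -(ler_nat R); apply: (le_trans r_le); rewrite ler_piMl.
(* The last summand absorbs the non-injective tuples, at most [k ^ 2 * 2 ^ k.-1] times
   [(q * s) ^ k.-1] in number. *)
have [s sdvd s_gt] : exists2 s,
    (k * l * k`! %| s)%N & (n0 + k + k ^ 2 * 2 ^ k.-1 < s)%N.
  have kl0 : (0 < k * l * k`!)%N by rewrite !muln_gt0 fact_gt0 !(ltn_trans _ kl) ltnW.
  set N := (n0 + k + _)%N; exists (k * l * k`! * N.+1)%N; first exact: dvdn_mulr.
  exact: leq_pmull.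
have [s0 n0s ks sb] : [/\ (0 < s)%N, (n0 <= s)%N, (k <= s)%N & (k ^ 2 * 2 ^ k.-1 <= s.-1)%N].
  by move: s_gt; move: (k ^ 2 * 2 ^ k.-1)%N => b; clear; split; lia.
pose H := @parity_graph k q s r eps.
have Hdiv : cycle_divisible k l H by exact: (@parity_graph_divisible k l q s r eps k2 sdvd).
have card_T : #|{: bool * 'I_q * 'I_s}| = (2 * q * s)%N.
  by rewrite !card_prod card_bool !card_ord.
have Ts : (s <= 2 * q * s)%N by rewrite leq_pmull // muln_gt0.
have Hndec : ~ cycle_decomposable k l H.
  move=> dec.
  have : 0 <= \sum_(e in H) w (\sum_(x in e) x.1.1)%N.
    apply: (@decomposable_sum R k l _ H (fun e => w (\sum_(x in e) x.1.1)%N)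
      (fun a => 0 <= a)) dec => //.
    - exact: ltnW.
    - by move=> a b; exact: addr_ge0.
    move=> y yinj _; have l0 : (0 < l)%N by apply: leq_trans kl.
    pose x n := (y (cyc l0 n)).1.1 : nat.
    rewrite (eq_bigr (fun i : 'I_l => w (\sum_(t < k) x (i + t))%N)).
      apply: w_cyc => [i|i]; last exact: leq_b1.
      by rewrite /x (_ : cyc l0 (i + l) = cyc l0 i) //; apply: val_inj; rewrite /= modnDr.
    move=> i _; congr w; rewrite big_imset /=; last by move=> ? ? _ _; exact: yinj.
    exact: (sum_tight_edge l0 (fun j => (y j).1.1 : nat) i (ltnW kl)).
  have := @parity_graph_weight R k q s r eps w k2 q0 rq w_ge w_bad.
  rewrite -/H => hW h0.
  have : 0 <= k`!%:R * \sum_(e in H) w (\sum_(x in e) x.1.1)%N by rewrite mulr_ge0.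
  rewrite leNgt => /negP; apply; apply: (le_lt_trans hW).
  set W' := \sum_(i < k.+1) _.
  (* Rounding [p] down to [r / q] only lowers the weight, by [w_bad]. *)
  have W'W : W' <= W.
    apply: ler_sum => i _; rewrite ler_wpM2l //; case: ifPn => // /w_bad wi.
    by rewrite ler_wpM2r // ler_pdivrMr ?ltr0n.
  pose m := ((q * s) ^ k.-1)%N.
  have m0 : 0 < m%:R :> R.
    by rewrite ltr0n expn_gt0 muln_gt0 q0 s0.
  have err1 : (k ^ 2 * (2 * q * s) ^ k.-1 <= s.-1 * m)%N.
    by rewrite -(mulnA 2) (expnMn 2) (mulnA (k ^ 2)%N) leq_mul // sb.
  have err2 : (2 * q * s ^ k <= 2 * s * m)%N.
    rewrite /m -(mulnA 2 q) -(mulnA 2 s); apply: leq_mul => //.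
    move: k2; case: (k) => [|[|j]] //= _.
    rewrite (expnS s) expnMn (mulnCA q); apply: leq_mul => //; apply: leq_mul => //.
    by rewrite (expnS q) leq_pmulr // expn_gt0 q0.
  have qs : (q * s)%:R ^+ k = (q * s)%:R * m%:R :> R.
    by rewrite natrX -exprS prednK // ltnW.
  rewrite qs.
  have err : (k ^ 2 * (2 * q * s) ^ k.-1 + 2 * q * s ^ k)%:R < 3 * s%:R * m%:R :> R.
    have : (k ^ 2 * (2 * q * s) ^ k.-1 + 2 * q * s ^ k < 3 * s * m)%N.
      have mN : (0 < m)%N by rewrite -(ltr_nat R).
      by move: err1 err2 mN s0; clear; move: m => m; nia.
    by rewrite -(ltr_nat R) !natrM.
  have : (q * s)%:R * m%:R * W' <= (q * s)%:R * m%:R * W.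
    by rewrite ler_wpM2l // mulr_ge0 // ltW.
  have : 3 * (s%:R * m%:R) <= - W * q%:R * (s%:R * m%:R).
    by rewrite ler_wpM2r // mulr_ge0.
  by move: err; rewrite natrM; lra.
apply: Hndec; apply: hn0 => //.
- by rewrite card_T (leq_trans n0s).
- exact: parity_graph_kgraph.
have := @min_degree_ge k.-1 ((q + r) * s - s - k.-1) _ H.
rewrite card_T => /(_ _)/wrap[].
  by rewrite (leq_trans _ Ts) // (leq_trans (leq_pred k)).
move=> /(_ _)/wrap[].
  move=> S Sk; rewrite !leq_subLR addnA [leqRHS]addnC addnA.
  exact: (@parity_graph_degree k q s r eps k2 q0 rq S Sk).
rewrite -(ler_nat R); apply: le_trans.
have q3 : (3 <= q)%N.
  rewrite -(ler_nat R); apply: (le_trans qe); rewrite ler_piMl // /e; lra.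
rewrite natrB ?natrB; last 2 first.
- by move: ks q3 s0; clear; nia.
- by move: ks q3 s0; clear; nia.
have -> : d + e = 1 / 2 + p / 2 - e by rewrite /e; lra.
have skR : k.-1%:R <= s%:R :> R by rewrite ler_nat (leq_trans (leq_pred k)).
have : 3 * s%:R <= 2 * e * q%:R * s%:R by rewrite ler_wpM2r.
have : p * q%:R * s%:R <= r.+1%:R * s%:R by rewrite ler_wpM2r // ltW.
rewrite !natrM natrD -natr1; move: skR; lra.
Qed.

(** * Forced densities *)

(** Pascal's rule pairs the types [i] and [i.+1], which differ in parity and cannot both carry a
    whole cycle when [k] does not divide [l]. *)
Lemma sum_bin_pascal (R : comPzRingType) (k : nat) (P : nat -> R) :
  \sum_(i < k.+2) 'C(k.+1, i)%:R * P i =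
  \sum_(i < k.+1) 'C(k, i)%:R * (P i + P i.+1).
Proof.
rewrite big_ord_recl bin0 mul1r.
under eq_bigr => i _ do rewrite lift0 binS natrD mulrDl.
under [RHS]eq_bigr => i _ do rewrite mulrDr.
rewrite !big_split /= addrA; congr (_ + _).
rewrite big_ord_recr [RHS]big_ord_recl /= bin0 mul1r bin_small // mul0r addr0.
by congr (_ + _); apply: eq_bigr => i _; rewrite lift0.
Qed.

Lemma sum_binE (R : comPzRingType) (k : nat) :
  \sum_(i < k.+1) 'C(k, i)%:R = 2 ^+ k :> R.
Proof.
rewrite -natr_sum -natrX; congr (_%:R).
by rewrite -[2%N]/(1 + 1)%N expnDn; apply: eq_bigr => i _; rewrite !exp1n !muln1.
Qed.

Lemma sum_bin_parity (R : comPzRingType) (k : nat) (eps : bool) (a b : R) : (0 < k)%N ->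
  \sum_(i < k.+1) 'C(k, i)%:R * (if odd i == eps then a else b) =
  2 ^+ k.-1 * (a + b).
Proof.
case: k => // k _.
rewrite (sum_bin_pascal k (fun i => if odd i == eps then a else b)) -sum_binE mulr_suml.
apply: eq_bigr => i _; congr (_ * _) => /=.
by case: (odd i); case: eps; rewrite //= addrC.
Qed.

Section ForcedDensity.
Variables (R : realType) (k l : nat) (d : R).
Hypotheses (k3 : (3 <= k)%N) (kl : (k < l)%N) (hd : forces_decomposition k l d).

Let l1 : 1 <= l%:R - 1 :> R.
Proof. by have : 2 <= l%:R :> R; [rewrite ler_nat; lia | lra]. Qed.

Lemma forced_density (eps : bool) (w : nat -> R) (p : R) : 0 <= p <= 1 ->
  (forall t, -1 <= w t) ->
  (forall t, odd t != eps -> l%:R / 2 - 1 <= w t) ->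
  (forall t, odd t = eps -> (t <= k)%N -> (k %| l * t)%N -> 0 <= w t) ->
  (forall t u, odd t = eps -> odd u != eps -> (t <= k)%N ->
     (u = t.+1 \/ t = u.+1) -> (k %| l.-1 * t + u)%N -> l%:R - 1 <= w u) ->
  \sum_(i < k.+1) 'C(k, i)%:R * (if odd i == eps then w i else p * w i) < 0 ->
  1 / 2 + p / 2 <= d.
Proof.
move=> p01 w1 wbad wconst wsingle W; apply: (space_barrier _ kl p01 w1 _ _ W hd).
- exact: ltnW.
- by move=> t /wbad; have := l1; lra.
by move=> x xl x1; apply: (cyclic_weight_ge0 _ xl x1 w1 wbad wconst wsingle); lia.
Qed.

Lemma density_limit (P : R) : 0 < P ->
  (forall p, 0 <= p -> p < P -> 1 / 2 + p / 2 <= d) -> 1 / 2 + P / 2 <= d.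
Proof.
move=> P0 hp; rewrite leNgt; apply/negP => dP.
(* The offending [p] is the midpoint of [2 * d - 1] and [P]; the case [p = 0] shows that it is
   nonnegative. *)
have := hp 0 (lexx 0) P0; have := hp ((2 * d - 1 + P) / 2); lra.
Qed.

(* The weights are -1 on the edges of parity [eps], l - 1 on the others, and 0
   on those of parity [eps] and a type [t] on which a whole cycle may live. *)
Lemma forced_density_parity (eps : bool) (z : R) : 0 <= z < 1 ->
  \sum_(i < k.+1) 'C(k, i)%:R * ((odd i == eps) && (k %| l * i)%N)%:R
    <= z * 2 ^+ k.-1 ->
  1 / 2 + (1 - z) / (2 * (l%:R - 1)) <= d.
Proof.
move=> /andP [z0 z1] hz.
have hl := l1.
have l0 : 0 < l%:R - 1 :> R by lra.
have -> : (1 - z) / (2 * (l%:R - 1)) = (1 - z) / (l%:R - 1) / 2.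
  by field; rewrite lt0r_neq0.
apply: density_limit => [|p p0 pz]; first by rewrite divr_gt0 // subr_gt0.
have {}pz : p * (l%:R - 1) < 1 - z by rewrite -ltr_pdivlMr.
have p1 : p <= 1 by have := ler_wpM2l p0 l1; lra.
pose w t : R := if odd t == eps then if (k %| l * t)%N then 0 else -1 else l%:R - 1.
apply: (@forced_density eps w) => //; first by rewrite p0.
- by move=> t; rewrite /w; case: ifP => _; [case: ifP => _; lra | lra].
- by move=> t /negPf tp; rewrite /w tp; lra.
- by move=> t te _ kt; rewrite /w te eqxx kt.
- by move=> t u _ /negPf up _ _ _; rewrite /w up.
have -> : \sum_(i < k.+1) 'C(k, i)%:R * (if odd i == eps then w i else p * w i) =
    \sum_(i < k.+1) 'C(k, i)%:R * (if odd i == eps then -1 else p * (l%:R - 1))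
    + \sum_(i < k.+1) 'C(k, i)%:R * ((odd i == eps) && (k %| l * i)%N)%:R.
  rewrite -big_split /=; apply: eq_bigr => i _; rewrite -mulrDr; congr (_ * _).
  by rewrite /w; case: (odd i == eps); case: (k %| _)%N; rewrite /= ?mulr1n ?mulr0n ?addr0 ?addNr.
rewrite sum_bin_parity; last by lia.
have : 0 < 2 ^+ k.-1 :> R by rewrite exprn_gt0.
move: hz; set S := \sum_(i < _) _; set Q := 2 ^+ _ => hz Q0.
have : Q * (p * (l%:R - 1)) < Q * (1 - z) by rewrite ltr_pM2l.
by move: hz; lra.
Qed.

(** Types carrying a whole cycle are never consecutive, so by Pascal's rule their binomial weight is
    at most [2 ^+ k.-1]. One of the parities has at most half of this, whence z = 1 / 2. *)
Lemma forced_density_half : ~~ (k %| l)%N -> 1 / 2 + 1 / (4 * (l%:R - 1)) <= d.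
Proof.
move=> ndvd.
have hl := l1.
pose Z eps : R := \sum_(i < k.+1) 'C(k, i)%:R * ((odd i == eps) && (k %| l * i)%N)%:R.
have ZZ : Z true + Z false <= 2 ^+ k.-1.
  rewrite /Z -big_split /=.
  rewrite (eq_bigr (fun i : 'I_k.+1 => 'C(k, i)%:R * (k %| l * i)%:R)); last first.
    move=> i _; rewrite -mulrDr; congr (_ * _).
    by case: (odd i); rewrite /= ?addr0 ?add0r.
  have -> : k.+1 = k.-1.+2 by lia.
  have -> : \sum_(i < k.-1.+2) 'C(k, i)%:R * (k %| l * i)%:R =
      \sum_(i < k.-1.+2) 'C(k.-1.+1, i)%:R * (k %| l * i)%:R :> R.
    by rewrite prednK //; lia.
  rewrite (sum_bin_pascal k.-1 (fun i => (k %| l * i)%:R : R)) -sum_binE.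
  apply: ler_sum => i _; rewrite ler_piMr //.
  rewrite -natrD lern1; case: (boolP (k %| l * i)%N) => [ki|_]; last exact: leq_b1.
  by rewrite mulnSr dvdn_addr // (negPf ndvd).
have [eps Zeps] : exists eps, Z eps <= 2^-1 * 2 ^+ k.-1.
  have [h|h] := lerP (Z true) (2^-1 * 2 ^+ k.-1); first by exists true.
  by exists false; move: ZZ h; move: (Z true) (Z false) (2 ^+ _) => a b c; lra.
have := @forced_density_parity eps 2^-1 _ Zeps.
have -> : (1 - 2^-1) / (2 * (l%:R - 1)) = 1 / (4 * (l%:R - 1)) :> R.
  by field; rewrite lt0r_neq0 //; lra.
by apply; lra.
Qed.

(** If [k] divides [l * i], then the even number [k %/ gcdn l k] divides [i]. So no odd type carries
    a whole cycle, and z = 0. *)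
Lemma forced_density_even :
  ~~ odd (k %/ gcdn l k) -> 1 / 2 + 1 / (2 * (l%:R - 1)) <= d.
Proof.
move=> even; have := @forced_density_parity true 0; rewrite subr0; apply.
  by rewrite lexx ltr01.
rewrite mul0r big1 // => i _; case: (boolP (odd i)) => [oi|]; last by rewrite mulr0.
suff -> : (k %| l * i)%N = false by rewrite mulr0.
apply/negP => kli; case/negP: even.
have g0 : (0 < gcdn l k)%N by rewrite gcdn_gt0; lia.
have kg : (k %/ gcdn l k %| i)%N.
  by rewrite dvdn_divLR ?dvdn_gcdr // mulnC muln_gcdl dvdn_gcd kli dvdn_mulr.
exact: dvdn_odd kg oi.
Qed.

(* The edges of odd type carry weight -1, except those of type k; the cycles
   with a single edge of even type determine that type modulo k, so one of
   the types 2 and k - 1 never occurs alone and needs only half the weight. *)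
Lemma forced_density_odd : (5 <= k)%N -> gcdn l k = 1%N -> odd k ->
  1 / 2 + 1 / (2 * (l%:R - 1)) <= d.
Proof.
move=> k5 lk ok.
have hl := l1.
have l0 : 0 < l%:R - 1 :> R by lra.
have -> : 1 / (2 * (l%:R - 1)) = 1 / (l%:R - 1) / 2 :> R.
  by field; rewrite lt0r_neq0.
apply: density_limit => [|p p0 pl]; first by rewrite divr_gt0.
have {}pl : p * (l%:R - 1) < 1 by rewrite -ltr_pdivlMr.
have p1 : p <= 1 by have := ler_wpM2l p0 l1; lra.
pose u0 := if (k %| 2 * l - 1)%N then 2%N else k.-1.
have u0_even : odd u0 = false by rewrite /u0; case: ifP => // _; lia.
have u0_bin : (2 <= 'C(k, u0))%N.
  rewrite /u0; case: ifP => _; first by rewrite bin2; nia.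
  by rewrite -bin_sub ?leq_pred // (_ : k - k.-1 = 1)%N ?bin1; lia.
(* For [u0 = 2], the neighbours t = 1 and t = 3 would give k | 3 and k | l. For [u0 = k.-1], t = k
   and t = k - 2 would give k | k - 1 and k | 2 l - 1. *)
have u0_single t : odd t -> (t <= k)%N -> (u0 = t.+1 \/ t = u0.+1) ->
    ~~ (k %| l.-1 * t + u0)%N.
  move=> ot tk; rewrite /u0; case: (boolP (k %| 2 * l - 1)%N) => [k2l|nk2l] tu.
    have [tE|tE] : t = 1%N \/ t = 3%N by lia.
      apply/negP => kt; suff /dvdn_leq : (k %| 3)%N by lia.
      rewrite -(dvdn_addr 3 k2l) (_ : 2 * l - 1 + 3 = 2 * (l.-1 * t + 2))%N ?dvdn_mull //.
      by rewrite tE; lia.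
    apply/negP => kt; suff kl' : (k %| l)%N.
      by move: lk; rewrite (gcdn_idPr kl'); lia.
    by rewrite -(dvdn_addr l k2l) (_ : 2 * l - 1 + l = l.-1 * t + 2)%N // tE; lia.
  have [tE|tE] : t = k \/ t = (k - 2)%N by lia.
    rewrite tE dvdn_addr ?dvdn_mull //; apply/negP => /dvdn_leq; lia.
  apply: contra nk2l => kt; rewrite -(dvdn_addr _ kt).
  have [[a lE] [b kE]] : (exists a, l = a.+1) /\ (exists b, k = b.+2).
    by split; [exists l.-1 | exists k.-2]; lia.
  rewrite (_ : l.-1 * t + k.-1 + (2 * l - 1) = l * k)%N ?dvdn_mull // tE lE kE.
  have -> : (b.+2 - 2 = b)%N by lia.
  have -> : (2 * a.+1 - 1 = a + a.+1)%N by lia.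
  by rewrite /= [RHS]mulSn !mulnS; clear; lia.
pose w t : R := if odd t then if t == k then 0 else -1
  else if t == u0 then l%:R / 2 - 1 else l%:R - 1.
apply: (@forced_density true w) => //; first by rewrite p0.
- by move=> t; rewrite /w; do 2?case: ifP => _; lra.
- by move=> t /negPf; rewrite eqb_id /w => ->; case: ifP => _; lra.
- move=> t ot tk; rewrite Gauss_dvdr; last by rewrite coprime_sym /coprime lk.
  move=> /dvdn_leq kt; rewrite /w ot; have -> : t = k; last by rewrite eqxx.
  by apply/eqP; rewrite eqn_leq tk kt //; case: (t) ot.
- move=> t u ot; rewrite eqb_id => /negPf ou tk tu; rewrite /w ou.
  case: eqP => // uu0; rewrite uu0 in tu *.
  by move/negP: (u0_single _ ot tk tu).
pose c i : R := if odd i == true then -1 else p * (l%:R - 1).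
have -> : \sum_(i < k.+1) 'C(k, i)%:R * (if odd i == true then w i else p * w i) =
    \sum_(i < k.+1) 'C(k, i)%:R * c i + 1 - 'C(k, u0)%:R * (p * (l%:R / 2)).
  have u0k : (u0 < k)%N by rewrite /u0; case: ifP; lia.
  have iE (i : 'I_k.+1) : 'C(k, i)%:R * (if odd i == true then w i else p * w i) =
      'C(k, i)%:R * c i + (if i == ord_max then 1 else 0)
      - (if i == Ordinal (ltnW u0k : u0 < k.+1)%N then 'C(k, u0)%:R * (p * (l%:R / 2)) else 0).
    rewrite /c /w !eqb_id -!val_eqE /=; case: (boolP (odd i)) => oi.
      have -> : (i == u0 :> nat) = false by apply: contraTF oi => /eqP ->; rewrite u0_even.
      by case: eqP => [->|_]; rewrite ?binn; ring.
    have -> : (i == k :> nat) = false by apply: contraNF oi => /eqP ->.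
    by case: eqP => [->|_]; field.
  under eq_bigr => i _ do rewrite iE.
  by rewrite !big_split /= sumrN -!big_mkcond !big_pred1_eq.
(* With Q = 2^(k - 1) and [u0_bin], the sum is at most (Q - 1) (p (l - 1) - 1) - p, which is
   negative. *)
rewrite sum_bin_parity; last by lia.
have : 2 <= 2 ^+ k.-1 :> R by rewrite -[leLHS]expr1 ler_weXn2l ?ler1n //; lia.
have : 2 * (p * (l%:R / 2)) <= 'C(k, u0)%:R * (p * (l%:R / 2)).
  by rewrite ler_wpM2r ?ler_nat // mulr_ge0 // divr_ge0.
move: pl p0; move: ('C(k, u0)%:R * _) (2 ^+ _) => B Q; nra.
Qed.
End ForcedDensity.

Theorem corollary2p4 (R : realType) (k l : nat)
  (hk : (3 <= k)%N) (hkl : (k < l)%N) (hndvd : ~~ (k %| l)%N) :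
  [/\ cycle_threshold R k l >= 1 / 2 + 1 / (4 * (l%:R - 1)),
      ~~ odd (k %/ gcdn l k) ->
        cycle_threshold R k l >= 1 / 2 + 1 / (2 * (l%:R - 1))
    & gcdn l k = 1%N -> odd k ->
        cycle_threshold R k l >= 1 / 2 + (1 - 2 ^- k) / (2 * (l%:R - 1)) ].
Proof.
have k0 : (0 < k)%N by apply: ltn_trans hk.
split=> [|even|lk ok]; apply: cycle_threshold_ge => // d hd.
- exact: (forced_density_half hk hkl hd).
- exact: (forced_density_even hk hkl hd).
have l4 : 4 <= l%:R :> R by rewrite ler_nat; lia.
have [k3|k_ne3] := eqVneq k 3%N.
  (* For k = 3 and l >= 4 the claimed bound is at most 1 / 2 + 7 / 48, which is below 2 / 3. *)
  rewrite k3 in hd; apply: le_trans (two_thirds_le _ hd); last by lia.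
  rewrite k3 -lerBrDl ler_pdivrMr; first by rewrite -exprVn; lra.
  lra.
have k5 : (5 <= k)%N by lia.
apply: le_trans (forced_density_odd hk hkl hd k5 lk ok).
rewrite lerD2l ler_wpM2r //; first by rewrite invr_ge0; lra.
by rewrite gerBl invr_ge0 exprn_ge0.
Qed.
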